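(* Let $\Omega\subset\mathbb{H}_1$ be a collared domain. Then for every boundary point $x\in\partial\Omega$ there exists a prime end $[E_k]$ of $\Omega$ with singleton impression $I[E_k]=\{x\}$.
   Context: Heisenberg group: $\mathbb{H}_1=\mathbb{C}\times\mathbb{R}$ with group law $(z_1,t_1)(z_2,t_2)=(z_1+z_2,\,t_1+t_2+2\,\mathrm{Im}(z_1\bar z_2))$, pseudonorm $\|(z,t)\|=(|z|^4+t^2)^{1/4}$, and distance $d(p,q)=\|p^{-1}q\|$. All metric and topological notions (balls $B(p,r)$, distance, length $l$, closure, boundary) are with respect to $d$. $\lambda$ is 3-dimensional Lebesgue measure. A domain is a nonempty open connected set. Modulus: a curve is a continuous map from an interval into $\mathbb{H}_1$; line integrals $\int_\gamma\varrho\,dl$ are taken with respect to $d$-arc length. For a family $\Gamma$ of curves, $\mathrm{Mod}_4\Gamma=\inf\int_{\mathbb{H}_1}\varrho^4\,d\lambda$ over all Borel $\varrho:\mathbb{H}_1\to[0,\infty]$ with $\int_\gamma\varrho\,dl\ge1$ for every locally rectifiable $\gamma\in\Gamma$ ($\mathrm{Mod}_4\Gamma=\infty$ if there is no such $\varrho$). $\mathrm{Mod}_4(E,F,\Omega)$ is the modulus of the family of rectifiable curves in $\Omega$, parametrized on closed intervals, joining $E$ and $F$. Prime ends: a connected set $E\subset\Omega$ is a cross-set of a domain $\Omega$ if (1) $E$ is relatively closed in $\Omega$, (2) $\overline{E}\cap\partial\Omega\neq\emptyset$, (3) $\Omega\setminus E$ consists of two components whose boundaries intersect $\partial\Omega$.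 A sequence $\{E_k\}_{k=1}^\infty$ of cross-sets is a chain if $E_k$ separates $E_{k-1}$ and $E_{k+1}$ within $\Omega$ for all $k$; $D(E_k)$ denotes the component of $\Omega\setminus E_k$ containing $E_{k+1}$; the impression is $I[E_k]=\bigcap_k\overline{D(E_k)}$. A chain is a prime chain if (a) $\mathrm{Mod}_4(E_{k+1},E_k,\Omega)<\infty$ for all $k$, and (b) $\lim_{k\to\infty}\mathrm{Mod}_4(E_k,K,\Omega)=0$ for every continuum $K\subset\Omega$ (a continuum is a compact connected set with more than one point). Two chains $\{E_k\},\{F_k\}$ are equivalent if each $D(E_k)$ contains all but finitely many of the $F_l$ and each $D(F_l)$ contains all but finitely many of the $E_k$. Equivalence classes $[E_k]$ of prime chains are the prime ends of $\Omega$ (the impression does not depend on the representative). Quasiconformality: a homeomorphism $f:\Omega\to\Omega'$ between domains is quasiconformal if there is $K<\infty$ with $\limsup_{r\to0}H_f(p,r)\le K$ for all $p\in\Omega$, where $H_f(p,r)=\frac{\sup\{d(f(p),f(q)):\,d(p,q)\le r\}}{\inf\{d(f(p),f(q)):\,d(p,q)\ge r\}}$. Uniform domain: a domain $U\subset\mathbb{H}_1$ is uniform if there are $\alpha,\beta>0$ such that each pair $x,y\in U$ can be joined by a rectifiable curve $\gamma$ in $U$ with $l(\gamma)\le\beta d(x,y)$ and $\alpha\min\{l(\gamma_{xz}),l(\gamma_{yz})\}\le\mathrm{dist}(z,\partial U)$ for all $z\in\gamma$, where $\gamma_{xz},\gamma_{yz}$ are the subarcs of $\gamma$ joining $x$ to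 $z$ and $y$ to $z$. Collared domain: $\Omega$ is locally quasiconformally collared at $x\in\partial\Omega$ if there are a uniform $U\subseteq\Omega$ and a quasiconformal map $h:U\to B(0,1)$ with $h(U)=B(0,1)$ such that (a) $x\in\partial U$; (b) $h$ extends homeomorphically to $\partial U\cap\partial\Omega$, with $h(\partial U\cap\partial\Omega)\subseteq\partial B(0,1)$ connected, closed, and containing $h(x)$ in its interior relative to $\partial B(0,1)$. $\Omega$ is collared if it is locally quasiconformally collared at every boundary point. *)

(* Defs.v *)
From HB Require Import structures.
From mathcomp Require Import all_boot all_order all_algebra.
From mathcomp Require Import ring lra.
From mathcomp Require Import all_classical all_reals all_analysis.
From mathcomp Require Import measurable_realfun.
Import Order.TTheory GRing.Theory Num.Theory.
Import numFieldNormedType.Exports.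

Set Implicit Arguments.
Unset Strict Implicit.
Unset Printing Implicit Defensive.

Local Open Scope classical_set_scope.
Local Open Scope ring_scope.

(* A point (z, t) of C x R is stored as ((x, y), t) with z = x + i y.  This is
   a fresh name for R * R * R, so that it carries the topology of the
   Heisenberg distance and not the product topology. *)
Definition heis (R : realType) : Type := (R * R * R)%type.

HB.instance Definition _ (R : realType) := Choice.on (heis R).

Section heisenberg_group.
Context {R : realType}.
Implicit Types p q r : heis R.

Definition hzero : heis R := (0, 0, 0).

(* Im (z1 * conj z2) = y1 * x2 - x1 * y2 *)
Definition hmul p q : heis R :=
  let: (x1, y1, t1) := p in let: (x2, y2, t2) := q in
  (x1 + x2, y1 + y2, t1 + t2 + 2 * (y1 * x2 - x1 * y2)).

Definition hinv p : heis R := let: (x, y, t) := p in (- x, - y, - t).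

(* |z|^4 = (x^2 + y^2)^2 *)
Definition hnorm p : R :=
  let: (x, y, t) := p in ((x ^+ 2 + y ^+ 2) ^+ 2 + t ^+ 2) `^ (4^-1).

Definition hdist p q : R := hnorm (hmul (hinv p) q).

Lemma hmulA p q r : hmul p (hmul q r) = hmul (hmul p q) r.
Proof.
case: p q r => [[x y] t] [[x' y'] t'] [[x2 y2] t2] /=.
by congr (_, _, _); ring.
Qed.

Lemma hmul0 p : hmul p hzero = p.
Proof. by case: p => [[x y] t] /=; congr (_, _, _); ring. Qed.

Lemma hmulV p : hmul p (hinv p) = hzero.
Proof. by case: p => [[x y] t] /=; congr (_, _, _); ring. Qed.

Lemma hmulVp p : hmul (hinv p) p = hzero.
Proof. by case: p => [[x y] t] /=; congr (_, _, _); ring. Qed.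

Lemma hinvM p q : hinv (hmul p q) = hmul (hinv q) (hinv p).
Proof.
by case: p q => [[x y] t] [[x' y'] t'] /=; congr (_, _, _); ring.
Qed.

Lemma hinvK : involutive hinv.
Proof. by case=> [[x y] t] /=; rewrite !opprK. Qed.

Lemma hnorm_ge0 p : 0 <= hnorm p.
Proof. by case: p => [[x y] t]; exact: powR_ge0. Qed.

Lemma hnorm4 (x y t : R) :
  hnorm (x, y, t) ^+ 4 = (x ^+ 2 + y ^+ 2) ^+ 2 + t ^+ 2.
Proof.
rewrite /hnorm -powR_mulrn ?powR_ge0// -powRrM mulVf// powRr1//.
by rewrite addr_ge0// sqr_ge0.
Qed.

Lemma hnormV p : hnorm (hinv p) = hnorm p.
Proof. by case: p => [[x y] t] /=; rewrite !sqrrN. Qed.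

Lemma hnorm0 : hnorm hzero = 0.
Proof.
by rewrite /hnorm /= !expr0n /= !addr0 expr0n powR0.
Qed.

Lemma hnorm_eq0 p : hnorm p = 0 -> p = hzero.
Proof.
case: p => [[x y] t] /(congr1 (fun u => u ^+ 4)); rewrite hnorm4 expr0n /=.
move/eqP; rewrite paddr_eq0 ?sqr_ge0// !sqrf_eq0.
rewrite paddr_eq0 ?sqr_ge0// !sqrf_eq0.
by move=> /andP[/andP[/eqP-> /eqP->] /eqP->].
Qed.

Lemma hnormM p q : hnorm (hmul p q) <= hnorm p + hnorm q.
Proof.
have bnd (u v : R) : 0 <= v -> u ^+ 2 <= v ^+ 2 -> u <= v.
  move=> v0 uv; have [u0|/ltW u0] := leP 0 u; last exact: le_trans v0.
  by rewrite -(@ler_pXn2r _ 2).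
rewrite -(@ler_pXn2r _ 4)// ?nnegrE ?addr_ge0 ?hnorm_ge0//.
have := hnorm_ge0 p; have := hnorm_ge0 q.
case: p q => [[x y] t] [[x' y'] t'].
rewrite [hmul _ _]/= hnorm4.
have := hnorm4 x y t; have := hnorm4 x' y' t'.
move: (hnorm (x, y, t)) (hnorm (x', y', t')) => N M EM EN M0 N0.
set s := x ^+ 2 + y ^+ 2 in EN; set s' := x' ^+ 2 + y' ^+ 2 in EM.
pose c := x * x' + y * y'; pose e := y * x' - x * y'.
have s0 : 0 <= s by rewrite addr_ge0// sqr_ge0.
have s'0 : 0 <= s' by rewrite addr_ge0// sqr_ge0.
have ce : c ^+ 2 + e ^+ 2 = s * s' by rewrite /c /e /s /s'; ring.
have sN : s <= N ^+ 2.
  by apply: bnd; rewrite ?sqr_ge0// -exprM EN lerDl sqr_ge0.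
have sM : s' <= M ^+ 2.
  by apply: bnd; rewrite ?sqr_ge0// -exprM EM lerDl sqr_ge0.
have ssNM : s * s' <= N ^+ 2 * M ^+ 2 by exact: ler_pM.
have CS (a b a' b' : R) :
    (a * a' + b * b') ^+ 2 <= (a ^+ 2 + b ^+ 2) * (a' ^+ 2 + b' ^+ 2).
  rewrite -subr_ge0 (_ : _ - _ = (a * b' - b * a') ^+ 2) ?sqr_ge0//; ring.
have b1 : s * s' + t * t' <= N ^+ 2 * M ^+ 2.
  apply: bnd; first by rewrite mulr_ge0// sqr_ge0.
  by apply: le_trans (CS _ _ _ _) _; rewrite -EN -EM exprMn -!exprM.
have b2 (u v L : R) : 0 <= L -> L ^+ 4 = u ^+ 2 + v ^+ 2 ->
    c * u + e * v <= N * M * L ^+ 2.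
  move=> L0 EL; apply: bnd; first by rewrite !mulr_ge0// sqr_ge0.
  apply: le_trans (CS _ _ _ _) _; rewrite -EL ce exprMn -exprM.
  by rewrite ler_wpM2r ?exprn_ge0// exprMn.
have := b2 _ _ _ N0 EN; have := b2 _ _ _ M0 EM.
rewrite (_ : (x + x') ^+ 2 + (y + y') ^+ 2 = s + s' + 2 * c); last first.
  by rewrite /s /s' /c; ring.
rewrite -/e => h1 h2.
have -> : (s + s' + 2 * c) ^+ 2 + (t + t' + 2 * e) ^+ 2 =
   N ^+ 4 + M ^+ 4 + 4 * (s * s') + 2 * (s * s' + t * t')
   + 4 * (c * s + e * t) + 4 * (c * s' + e * t').
  by rewrite EN EM /c /e /s /s'; ring.
have -> : (N + M) ^+ 4 = N ^+ 4 + M ^+ 4 + 4 * (N ^+ 2 * M ^+ 2)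
   + 2 * (N ^+ 2 * M ^+ 2) + 4 * (N * M * N ^+ 2) + 4 * (N * M * M ^+ 2).
  by ring.
lra.
Qed.

Lemma hdistxx p : hdist p p = 0.
Proof. by rewrite /hdist hmulVp hnorm0. Qed.

Lemma hdist_positivity p q : hdist p q = 0 -> p = q.
Proof.
move=> /hnorm_eq0 /(congr1 (hmul p)).
rewrite hmulA hmulV hmul0 => <-.
by case: q => [[x y] t] /=; congr (_, _, _); ring.
Qed.

Lemma hdist_sym p q : hdist p q = hdist q p.
Proof. by rewrite /hdist -hnormV hinvM hinvK. Qed.

Lemma hdist_triangle q p r : hdist p r <= hdist p q + hdist q r.
Proof.
rewrite /hdist; apply: le_trans (hnormM _ _).
by rewrite -hmulA (hmulA q) hmulV (_ : hmul hzero r = r)//;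
  case: r => [[x y] t] /=; congr (_, _, _); ring.
Qed.

End heisenberg_group.

HB.instance Definition _ (R : realType) := isMetric.Build R (heis R)
  (@hdistxx R) (@hdist_positivity R) (@hdist_sym R) (@hdist_triangle R).
HB.instance Definition _ (R : realType) := isPointed.Build (heis R) hzero.

Section heisenberg_domains.
Context {R : realType}.
Implicit Types (p q x y : heis R) (A B E F K U O : set (heis R)).

Lemma hballE p (r : R) : ball p r = [set q | hdist p q < r].
Proof. exact: ballEmdist. Qed.

Definition boundary A := closure A `\` interior A.

Definition domain O := [/\ O !=set0, open O & connected O].

Definition components A := [set connected_component A x | x in A].

Local Open Scope ereal_scope.

(* Length of the restriction of g to [a, b]; itv_partition a b s says that
   a :: s is an increasing subdivision of [a, b]. *)
Definition length (a b : R) (g : R -> heis R) : \bar R :=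
  ereal_sup [set (\sum_(0 <= i < size s)
      hdist (g (nth b (a :: s) i)) (g (nth b (a :: s) i.+1)))%:E
    | s in itv_partition a b].

(* Only the values of cmap on cdom are meaningful. *)
Record curve := Curve {
  cdom : interval R ;
  cmap :> R -> heis R ;
  cdom_neq0 : [set` cdom] !=set0 ;
  cmap_continuous : {within [set` cdom], continuous cmap} }.

Definition locally_rectifiable (c : curve) := forall a b : R,
  (a <= b)%R -> a \in cdom c -> b \in cdom c -> length a b c < +oo.

(* The point at arc length s from g a on the restriction of g to [a, b]; for
   0 <= s <= length a b g < +oo and g continuous on [a, b] it exists and does
   not depend on the chosen parameter, g being constant between two
   parameters with the same arc length. *)
Definition arclength_param (a b : R) (g : R -> heis R) (s : R) : heis R :=
  g (xget a [set u | u \in `[a, b] /\ length a u g = s%:E]).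

Definition line_integral_itv (a b : R) (g : R -> heis R)
    (rho : heis R -> \bar R) : \bar R :=
  \int[lebesgue_measure]_(s in `[0%R, fine (length a b g)])
    rho (arclength_param a b g s).

(* The integral over a locally rectifiable curve is the supremum of the
   integrals over its compact subcurves; if cdom c is itself a closed interval
   this is the integral over cdom c, since rho >= 0. *)
Definition line_integral (c : curve) (rho : heis R -> \bar R) : \bar R :=
  ereal_sup [set v | exists a b : R,
    [/\ (a <= b)%R, a \in cdom c, b \in cdom c
      & v = line_integral_itv a b c rho]].

(* Borel for the topology of hdist *)
Definition borel_fun (rho : heis R -> \bar R) :=
  measurable_fun setT (rho : g_sigma_algebraType (@open (heis R)) -> \bar R).

Definition lebesgue3 :
    set (measurableTypeR R * measurableTypeR R * measurableTypeR R) -> \bar R :=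
  (lebesgue_measure \x lebesgue_measure) \x lebesgue_measure.

Definition admissible (G : set curve) (rho : heis R -> \bar R) :=
  [/\ borel_fun rho, (forall p, 0 <= rho p)
    & forall c, G c -> locally_rectifiable c -> 1 <= line_integral c rho].

Definition Mod4 (G : set curve) : \bar R :=
  ereal_inf [set \int[lebesgue3]_p (rho p ^+ 4) | rho in admissible G].

Definition joining_curves E F O : set curve := [set c | exists a b : R,
  [/\ (a <= b)%R, cdom c = `[a, b], length a b c < +oo,
      (forall u, u \in `[a, b] -> O (c u))
    & (E (c a) /\ F (c b)) \/ (F (c a) /\ E (c b))]].

Definition Mod4_joining E F O : \bar R := Mod4 (joining_curves E F O).

Definition cross_set O E :=
  [/\ E `<=` O, connected E, (exists2 C, closed C & E = C `&` O),
      closure E `&` boundary O !=set0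
    & exists C1 C2, [/\ C1 <> C2, components (O `\` E) = [set C1; C2],
        boundary C1 `&` boundary O !=set0
      & boundary C2 `&` boundary O !=set0]].

Definition separates O E A B := exists C1 C2,
  [/\ components (O `\` E) C1, components (O `\` E) C2, C1 <> C2,
      A `<=` C1 & B `<=` C2].

(* Chains are indexed from 0. *)
Definition chain O (E : nat -> set (heis R)) :=
  (forall k, cross_set O (E k)) /\
  (forall k, separates O (E k.+1) (E k) (E k.+2)).

(* The component of O minus E k containing E k.+1; in a chain there is exactly
   one such component, so that the union has one term. *)
Definition chain_side O (E : nat -> set (heis R)) (k : nat) : set (heis R) :=
  \bigcup_(C in [set C | components (O `\` E k) C /\ E k.+1 `<=` C]) C.

Definition chain_impression O (E : nat -> set (heis R)) : set (heis R) :=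
  \bigcap_k closure (chain_side O E k).

Definition continuum K :=
  [/\ compact K, connected K & exists p q, [/\ K p, K q & p <> q]].

Definition prime_chain O (E : nat -> set (heis R)) :=
  [/\ chain O E, (forall k, Mod4_joining (E k.+1) (E k) O < +oo)
    & forall K, continuum K -> K `<=` O ->
        Mod4_joining (E k) K O @[k --> \oo] --> 0].

Definition chain_equiv O (E F : nat -> set (heis R)) :=
  (forall k, \forall l \near \oo, F l `<=` chain_side O E k) /\
  (forall l, \forall k \near \oo, E k `<=` chain_side O F l).

Definition chain_class O (E : nat -> set (heis R)) :=
  [set F | prime_chain O F /\ chain_equiv O E F].

Definition prime_end O (P : set (nat -> set (heis R))) :=
  exists2 E, prime_chain O E & P = chain_class O E.

(* All representatives of a prime end have the same impression; the union is
   over its representatives. *)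
Definition impression O (P : set (nat -> set (heis R))) : set (heis R) :=
  \bigcup_(E in P) chain_impression O E.

(* Only the values of f on A are meaningful. *)
Definition homeomorphism A B (f : heis R -> heis R) :=
  [/\ f @` A = B, {within A, continuous f}
    & exists2 g : heis R -> heis R,
        {within B, continuous g} & {in A, cancel f g}].

(* f has domain O, so q ranges over O *)
Definition distortion O (f : heis R -> heis R) p (r : R) : \bar R :=
  ereal_sup [set (hdist (f p) (f q))%:E | q in [set q | O q /\ (hdist p q <= r)%R]]
  / ereal_inf [set (hdist (f p) (f q))%:E | q in [set q | O q /\ (r <= hdist p q)%R]].

Definition quasiconformal O O' (f : heis R -> heis R) :=
  [/\ domain O, domain O', homeomorphism O O' f
    & exists K : R, forall p, O p ->
        limf_esup (distortion O f p) 0^'+ <= K%:E].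

(* +oo when A is empty *)
Definition dist_set p A : \bar R := ereal_inf [set (hdist p q)%:E | q in A].

Definition uniform_domain U := domain U /\
  exists alpha beta : R, [/\ (0 < alpha)%R, (0 < beta)%R
    & forall x y, U x -> U y -> exists (a b : R) (g : R -> heis R),
      [/\ [/\ (a <= b)%R, {within `[a, b], continuous g}, g a = x & g b = y],
          (forall s, s \in `[a, b] -> U (g s)),
          length a b g < +oo,
          length a b g <= (beta * hdist x y)%:E
        & forall s, s \in `[a, b] ->
            alpha%:E * Order.min (length a s g) (length s b g)
              <= dist_set (g s) (boundary U)]].

Definition locally_collared O x :=
  exists (U : set (heis R)) (h : heis R -> heis R),
    let S := boundary U `&` boundary O in
    let sphere := boundary (ball (@hzero R) 1%R) in
    [/\ [/\ uniform_domain U, U `<=` O & quasiconformal U (ball hzero 1%R) h],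
        boundary U x,
        (* h also stands for its extension to U `|` S *)
        homeomorphism (U `|` S) (h @` (U `|` S)) h
      & [/\ h @` S `<=` sphere, connected (h @` S), closed (h @` S)
        & exists V, [/\ open V, V (h x) & V `&` sphere `<=` h @` S]]].

Definition collared O :=
  domain O /\ forall x, boundary O x -> locally_collared O x.

End heisenberg_domains.

(* Main.v *)
Require Import Defs.
From mathcomp Require Import all_boot all_order all_algebra.
From mathcomp Require Import all_classical all_reals all_analysis.
From mathcomp Require Import measurable_realfun.
From mathcomp Require Import ring lra.
Import Order.TTheory GRing.Theory Num.Theory.
Import numFieldNormedType.Exports.

(* Let h map U onto the Koranyi ball B and put o = h(x). The function
   F(z, t) = |z|^4 + t^2 is strictly convex for the linear structure of R^3, so
   with L the derivative of F at o the half-space cuts {L > -c} of B shrink to o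
   as c decreases to 0. The prime end at x is the chain of the preimages
   E_k of the slices {L = -c_k} of B, which are convex and hence connected.
   The part of Omega below E_k is connected: a clopen part of it that misses
   the preimage of {L < -c_k} misses U, hence is clopen in Omega.
   Disjoint slices lie at positive distance, which bounds the modulus between
   them; slices near x are joined to a fixed continuum only by curves crossing
   many dyadic annuli around x, each of them contributing O(n^-4) to the modulus
   of order n^-3.
   Finally, a chain F equivalent to E has the same impression: the sets D(F_l)
   decrease, no point lies in all D(E_m), and every Omega \ D(E_m) is connected,
   so that some D(F_l) is contained in D(E_k). *)

Set Implicit Arguments.
Unset Strict Implicit.
Unset Printing Implicit Defensive.

Local Open Scope classical_set_scope.
Local Open Scope ring_scope.

(** * Connected sets and components *)

(** The obstacle is that the inverse g of h is continuous only on h(U) together with h(S), where S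
    is the common boundary of U and Omega; nothing is known near the rest of the sphere. Strict
    convexity removes it: for c <= c0 with c0 small, the closed cap {F <= 1, L >= -c} meets the
    sphere only inside h(S), so g maps it onto a compact set. Since S lies outside the open set
    Omega, this compact set meets Omega exactly in the preimage of {L >= -c} in U. The relative
    closedness of the E_k, the openness of the part below E_k, the positive distance between two
    slices and the convergence to x all come from these compact images. Moduli are estimated
    directly in Omega, with test functions that are constant on a ball or on annuli. They use that
    an arc-length parametrization is 1-Lipschitz and that a ball of radius r lies in a set of volume
    8 r^4. The exponent of the modulus equals this power of r, so all dyadic annuli contribute
    equally. *)

Lemma closure_image_within (T U : topologicalType) (Y A : set T) (f : T -> U) y :
  {within Y, continuous f} -> Y y -> A `<=` Y -> closure A y ->
  closure (f @` A) (f y).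
Proof.
move=> cf Yy AY cAy B nB.
have : nbhs (y : subspace Y) (f @^-1` B) := cf y B nB.
rewrite /nbhs/= -(nbhs_subspace_in Yy) => /cAy [z [Az fz]].
by exists (f z); split; [exists z | exact: fz (AY _ Az)].
Qed.

Lemma open_setI_preimage (T U : topologicalType) (O : set T) (V : set U)
    (f : T -> U) :
  open O -> {within O, continuous f} -> open V -> open (O `&` f @^-1` V).
Proof.
by move=> oO; rewrite continuous_open_subspace// => /(continuous_inP _ oO); exact.
Qed.

Lemma connected_sub_open (T : topologicalType) (A C1 C2 : set T) :
  connected A -> open C1 -> open C2 -> A `<=` C1 `|` C2 ->
  C1 `&` C2 `<=` ~` A -> A `&` C1 !=set0 -> A `<=` C1.
Proof.
move=> cA o1 o2 AC dC A1.
have <- : A `&` C1 = A.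
  apply: cA => //; first by exists C1.
  exists (~` C2); first exact: open_closedC.
  apply/seteqP; split=> z [Az]; first by move=> C1z; split=> // C2z; exact: (dC z).
  by move=> nC2; split=> //; case: (AC _ Az).
by move=> z [].
Qed.

Lemma connected_between (T : topologicalType) (C D : set T) :
  connected C -> C `<=` D -> D `<=` closure C -> connected D.
Proof.
move=> cC CD DC B [b Bb] [V oV BV] [F cF BF].
have CB : C `&` V = C.
  apply: cC.
  - have [Db Vb] : (D `&` V) b by rewrite -BV.
    have [z [Cz Vz]] := DC _ Db _ (open_nbhs_nbhs (conj oV Vb)).
    by exists z.
  - by exists V.
  - exists F => //; apply/seteqP; split=> z [Cz zz]; split=> //.
      by have : B z; [rewrite BV; split=> //; exact: CD | rewrite BF => -[]].
    by have : B z; [rewrite BF; split=> //; exact: CD | rewrite BV => -[]].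
have CF : C `<=` F.
  move=> z; rewrite -{1}CB => -[Cz Vz].
  by have : B z; [rewrite BV; split=> //; exact: CD | rewrite BF => -[]].
rewrite BF; apply/setIidPl => z /DC.
by rewrite (closure_id F).1//; exact: closureS.
Qed.

(** By [connected_between] the trace on A of the closure of a component is still connected, so
    maximality absorbs it. *)
Lemma connected_component_relclosed (T : topologicalType) (A : set T) (a : T) :
  A `&` closure (connected_component A a) `<=` connected_component A a.
Proof.
have [Aa|nAa] := pselect (A a); last first.
  by rewrite connected_component_out// closure0 setI0.
apply: connected_component_max.
- by split=> //; exact/subset_closure/connected_component_refl.
- by move=> z [].
apply: (@connected_between _ (connected_component A a)).
- exact: component_connected.
- by move=> z Cz; split; [exact: connected_component_sub Cz|exact: subset_closure].
- by move=> z [].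
Qed.

Section components.
Context {R : realType}.
Implicit Types O A C E F : set (heis R).

Lemma components_two A C1 C2 :
  A = C1 `|` C2 -> C1 `&` C2 = set0 -> open C1 -> open C2 ->
  connected C1 -> connected C2 -> C1 !=set0 -> C2 !=set0 ->
  components A = [set C1; C2].
Proof.
move=> AC C12 o1 o2 c1 c2 [z1 Cz1] [z2 Cz2].
have cc (D D' : set (heis R)) z : A = D `|` D' -> D `&` D' = set0 -> open D ->
    open D' -> connected D -> D z -> connected_component A z = D.
  move=> AD dD oD oD' cD Dz; apply/seteqP; split.
    have Az : A z by rewrite AD; left.
    apply: (@connected_sub_open _ _ _ D') => //.
    - exact: component_connected.
    - by rewrite -AD; exact: connected_component_sub.
    - by rewrite dD.
    - by exists z; split=> //; exact: connected_component_refl.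
  by apply: connected_component_max => //; rewrite AD => w; left.
have CA : A = C2 `|` C1 by rewrite setUC.
have C21 : C2 `&` C1 = set0 by rewrite setIC.
apply/seteqP; split=> D.
  move=> [z]; rewrite {1}AC => -[Cz|Cz] <-.
    by left; exact: (cc C1 C2).
  by right; exact: (cc C2 C1).
move=> [->|->].
  by exists z1; [rewrite AC; left|exact: (cc C1 C2)].
by exists z2; [rewrite AC; right|exact: (cc C2 C1)].
Qed.

Lemma connected_of_component A C : components A C -> connected C.
Proof. by move=> [a _ <-]; exact: component_connected. Qed.

Lemma component_sub A C : components A C -> C `<=` A.
Proof. by move=> [a _ <-]; exact: connected_component_sub. Qed.

Lemma component_neq0 A C : components A C -> C !=set0.
Proof. by move=> [a Aa <-]; exists a; exact: connected_component_refl. Qed.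

Lemma component_max A C B z :
  components A C -> C z -> B z -> B `<=` A -> connected B -> B `<=` C.
Proof.
move=> [a Aa <-] Cz Bz BA cB.
rewrite (same_connected_component Cz).
exact: connected_component_max.
Qed.

Lemma component_uniq A C C' z : components A C -> components A C' -> C z -> C' z ->
  C = C'.
Proof.
move=> cC cC' Cz C'z; apply/seteqP; split.
  exact: component_max cC' C'z Cz (component_sub cC) (connected_of_component cC).
exact: component_max cC Cz C'z (component_sub cC') (connected_of_component cC').
Qed.

Lemma component_exists A B : connected B -> B `<=` A -> B !=set0 ->
  exists2 C, components A C & B `<=` C.
Proof.
move=> cB BA [b Bb]; exists (connected_component A b).
  by exists b => //; exact: BA.
exact: connected_component_max.
Qed.

Lemma cross_set_neq0 O E : cross_set O E -> E !=set0.
Proof.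
by move=> [_ _ _ [z [Ez _]] _]; have [y []] := Ez _ filterT; exists y.
Qed.

Lemma cross_set_open_diff O E : open O -> cross_set O E -> open (O `\` E).
Proof.
move=> oO [_ _ [C cC ->] _ _].
rewrite setDE setCI setIUr setICr setU0.
by apply: openI => //; exact: closed_openC.
Qed.

Lemma component_relclosed A C : components A C -> A `&` closure C `<=` C.
Proof. by move=> [a _ <-]; exact: connected_component_relclosed. Qed.

(** A cross-set leaves exactly two components, each closed relative to the open set [O \ E]. Hence
    each is the part of that set outside the closure of the other. *)
Lemma cross_set_component_open O E C : open O -> cross_set O E ->
  components (O `\` E) C -> open C.
Proof.
move=> oO cE cC; have oOE := cross_set_open_diff oO cE.
case: cE => _ _ _ _ [C1 [C2 [C12 cE _ _]]].
have [C' [cC' CC' CU]] : exists C', [/\ components (O `\` E) C', C <> C' &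
    forall z, (O `\` E) z -> C z \/ C' z].
  have all (z : heis R) : (O `\` E) z -> C1 z \/ C2 z.
    move=> Az; have : components (O `\` E) (connected_component (O `\` E) z).
      by exists z.
    by rewrite cE => -[<-|<-]; [left|right]; exact: connected_component_refl.
  move: cC; rewrite cE => -[->|->].
    by exists C2; split=> //; right.
  exists C1; split; [by left|by move=> /esym|].
  by move=> z /all [|]; [right|left].
have -> : C = (O `\` E) `&` ~` closure C'.
  apply/seteqP; split=> z.
    move=> Cz; split; first exact: (component_sub cC Cz).
    move=> C'z; apply: CC'; apply: (component_uniq cC cC' Cz).
    by apply: (component_relclosed cC'); split=> //; exact: (component_sub cC Cz).
  by move=> [/CU[//|C'z]]; case; exact: subset_closure.
by apply: openI => //; exact/closed_openC/closed_closure.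
Qed.

(** Otherwise C would be clopen in the connected set O, hence all of O, although the nonempty set E
    is disjoint from C. *)
Lemma component_closure_meets O E C : open O -> connected O ->
  cross_set O E -> components (O `\` E) C -> closure C `&` E !=set0.
Proof.
move=> oO cO cE cC; apply: contrapT => CE.
have oC := cross_set_component_open oO cE cC.
have EO : E `<=` O by case: cE.
have CO : C = O.
  apply: cO; first exact: component_neq0 cC.
    exists C => //; apply/esym/setIidPr => z /(component_sub cC)[] //.
  exists (closure C); first exact: closed_closure.
  apply/seteqP; split=> z.
    by move=> Cz; split; [case: (component_sub cC Cz)|exact: subset_closure].
  move=> [Oz Cz]; apply: (component_relclosed cC); split=> //; split=> // Ez.
  by apply: CE; exists z.
have [e Ee] := cross_set_neq0 cE.
have : C e by rewrite CO; exact: EO.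
by move=> /(component_sub cC)[].
Qed.

End components.

(** * Chains and impressions *)

Section chains.
Context {R : realType}.
Implicit Types O : set (heis R).
Implicit Types E F : nat -> set (heis R).

Lemma chain_disjoint O F k : chain O F -> F k.+1 `<=` O `\` F k.
Proof.
move=> [cr sep] z Fz; split; first by case: (cr k.+1) => + _ _ _ _; exact.
move=> Fkz; have [C1 [C2 [c1 c2 C12 F1 F2]]] := sep k.
by have [] := component_sub c1 (F1 _ Fkz).
Qed.

Lemma chain_side_component O F k : chain O F ->
  components (O `\` F k) (chain_side O F k) /\ F k.+1 `<=` chain_side O F k.
Proof.
move=> cF; have [cr sep] := cF.
have [y Fy] := cross_set_neq0 (cr k.+1).
have conF : connected (F k.+1) by case: (cr k.+1).
have [C cC FC] := component_exists conF (chain_disjoint cF) (cross_set_neq0 (cr k.+1)).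
suff -> : chain_side O F k = C by [].
apply/seteqP; split=> [z [C' [/= cC' FC'] C'z]|z Cz]; last by exists C.
by rewrite (component_uniq cC cC' (FC _ Fy) (FC' _ Fy)).
Qed.

(** [F k] and [F k.+2] lie in different components off [F k.+1], and [chain_side O F k.+1] is the
    component of the latter. *)
Lemma chain_side_prev O F k : chain O F -> F k `&` chain_side O F k.+1 = set0.
Proof.
move=> cF; have [cr sep] := cF.
have [C1 [C2 [c1 c2 C12 F1 F2]]] := sep k.
have [cD FD] := chain_side_component k.+1 cF.
have [y Fy] := cross_set_neq0 (cr k.+2).
have DC2 := component_uniq cD c2 (FD _ Fy) (F2 _ Fy).
rewrite -subset0 => z [Fz]; rewrite DC2 => C2z.
exact: C12 (component_uniq c1 c2 (F1 _ Fz) C2z).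
Qed.

(** The closure of the connected set [chain_side O F k.+1] reaches [F k.+1], which lies in the open
    set [chain_side O F k]. So the two sides meet, and as the first misses [F k], maximality of the
    component gives the inclusion. *)
Lemma chain_side_succ O F k : open O -> connected O -> chain O F ->
  chain_side O F k.+1 `<=` chain_side O F k.
Proof.
move=> oO cO cF; have [cr _] := cF.
have [cD FD] := chain_side_component k.+1 cF.
have [cD' FD'] := chain_side_component k cF.
have oD' := cross_set_component_open oO (cr k) cD'.
have [y [cDy Fy]] := component_closure_meets oO cO (cr k.+1) cD.
have [z [Dz D'z]] := cDy _ (open_nbhs_nbhs (conj oD' (FD' _ Fy))).
apply: (component_max cD' D'z Dz); last exact: connected_of_component cD.
move=> w Dw; split; first by case: (component_sub cD Dw).
move=> Fw; have : (F k `&` chain_side O F k.+1) w by [].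
by rewrite chain_side_prev.
Qed.

Lemma chain_side_leq O F k l : open O -> connected O -> chain O F ->
  (k <= l)%N -> chain_side O F l `<=` chain_side O F k.
Proof.
move=> oO cO cF /subnK <-; elim: (l - k)%N => [|n IH] //.
by apply: subset_trans IH; rewrite addSn; exact: chain_side_succ.
Qed.

Lemma chain_side_sub O F k l : open O -> connected O -> chain O F ->
  (k < l)%N -> F l `<=` chain_side O F k.
Proof.
move=> oO cO cF; case: l => // l kl.
apply: subset_trans (chain_side_component l cF).2 _.
exact: chain_side_leq.
Qed.

Lemma chain_side_notin O F k l z : open O -> connected O -> chain O F ->
  (k <= l)%N -> F k z -> ~ chain_side O F l z.
Proof.
move=> oO cO cF kl Fz /(chain_side_leq oO cO cF kl).
by move=> /(component_sub (chain_side_component k cF).1)[].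
Qed.

(** Fix p in [F 0] and m >= k with p outside D(E_m), then l with F_l inside D(E_m). If D(F_l) had a
    point z outside D(E_k), the connected set O minus D(E_m) would contain z and miss F_l, so it
    would lie in D(F_l). Then p would belong to D(F_l), which a point of [F 0] cannot. *)
Lemma chain_equiv_side O E F k : open O -> connected O ->
  chain O E -> chain O F -> chain_equiv O E F ->
  (forall m, connected (O `\` chain_side O E m)) ->
  (forall p, O p -> exists m, ~ chain_side O E m p) ->
  exists l, chain_side O F l `<=` chain_side O E k.
Proof.
move=> oO cO cE cF [EF _] conn empty; apply: contrapT => /forallNP noF.
have [crF _] := cF.
have [p Fp] := cross_set_neq0 (crF 0).
have Op : O p by case: (crF 0) => + _ _ _ _; exact.
have [m0 m0p] := empty p Op.
pose m := maxn m0 k.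
have mp : ~ chain_side O E m p.
  by move=> /(chain_side_leq oO cO cE (leq_maxl m0 k)).
have [l _ /(_ l (leqnn l)) FlD] := EF m.
have /existsNP[z /not_implyP[Flz Ez]] := noF l.
have Fl := chain_side_component l cF.
apply: (@chain_side_notin O F 0 l p) => //.
apply: (@component_max _ _ _ (O `\` chain_side O E m) z Fl.1 Flz) (conj Op mp).
- split; first by case: (component_sub Fl.1 Flz).
  by move=> /(chain_side_leq oO cO cE (leq_maxr m0 k)).
- by move=> w [Ow Dw]; split=> // /FlD.
- exact: conn.
Qed.

Lemma impression_chain_class O E x : open O -> connected O ->
  prime_chain O E -> (forall m, connected (O `\` chain_side O E m)) ->
  (forall p, O p -> exists m, ~ chain_side O E m p) ->
  chain_impression O E = [set x] ->
  impression O (chain_class O E) = [set x].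
Proof.
move=> oO cO pE conn empty Ex; have [cE _ _] := pE.
apply/seteqP; split=> [y [F [[cF _ _] EF] Fy]|y].
  rewrite -Ex => k _.
  have [l FE] := chain_equiv_side k oO cO cE cF EF conn empty.
  exact: closureS FE _ (Fy l I).
rewrite -Ex => Ey; exists E => //; split=> //.
by split=> k; exists k.+1 => // l kl; exact: chain_side_sub.
Qed.

End chains.

(** * Arc length *)

Section length_theory.
Context {R : realType}.
Implicit Types (g : R -> heis R) (a b c u w : R).

(** The sum in [length] in recursive form, for inductions on the subdivision. *)
Fixpoint pathlen g a (s : seq R) : R :=
  if s is t :: s' then hdist (g a) (g t) + pathlen g t s' else 0.

Lemma hdist_ge0 (p q : heis R) : 0 <= hdist p q.
Proof. exact: hnorm_ge0. Qed.

Lemma lengthE a b g :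
  length a b g = ereal_sup [set (pathlen g a s)%:E | s in itv_partition a b].
Proof.
rewrite /length; congr ereal_sup; apply: eq_imagel => s _; congr EFin.
elim: s a => [|t s IH] a /=; first by rewrite big_geq.
by rewrite big_nat_recl//= -IH.
Qed.

Lemma pathlen_cat g a (s1 s2 : seq R) :
  pathlen g a (s1 ++ s2) = pathlen g a s1 + pathlen g (last a s1) s2.
Proof. by elim: s1 a => [|t s IH] a /=; rewrite ?add0r// IH addrA. Qed.

Lemma pathlen_rcons g a (s : seq R) t :
  pathlen g a (rcons s t) = pathlen g a s + hdist (g (last a s)) (g t).
Proof. by rewrite -cats1 pathlen_cat /= addr0. Qed.

Lemma pathlen_le_length g a b s : itv_partition a b s ->
  ((pathlen g a s)%:E <= length a b g)%E.
Proof. by move=> abs; rewrite lengthE; apply: ereal_sup_ubound; exists s. Qed.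

Lemma hdist_le_length g a b : a <= b -> ((hdist (g a) (g b))%:E <= length a b g)%E.
Proof.
rewrite le_eqVlt => /predU1P[<-|ab].
  by rewrite hdistxx; exact: (@pathlen_le_length _ _ _ [::]).
have := @pathlen_le_length g a b [:: b] (itv_partition1 ab).
by rewrite /= addr0.
Qed.

Lemma length_ge0 g a b : a <= b -> (0 <= length a b g)%E.
Proof.
by move=> ab; apply: le_trans (hdist_le_length g ab); rewrite lee_fin hdist_ge0.
Qed.

Lemma lengthxx g a : length a a g = 0%E.
Proof.
rewrite lengthE; apply/le_anti/andP; split.
  by apply/ereal_supP => _ [s /itv_partitionxx -> <-].
by apply: ereal_sup_ubound; exists [::].
Qed.

Lemma le_length_add g a b c : a <= b -> b <= c ->
  (length a b g + length b c g <= length a c g)%E.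
Proof.
(* With a finite right-hand side, terms can be moved across the inequality, and the two suprema on
   the left are taken one after the other. *)
move=> ab bc; have [->|] := eqVneq (length a c g) +oo%E; first exact: leey.
rewrite -ltey => fin.
have ac0 := @length_ge0 g _ _ (le_trans ab bc).
have acf : length a c g \is a fin_num by rewrite ge0_fin_numE.
have key s t : itv_partition a b s -> itv_partition b c t ->
    ((pathlen g a s)%:E + (pathlen g b t)%:E <= length a c g)%E.
  move=> abs bct; have := pathlen_le_length g (itv_partition_cat abs bct).
  by rewrite pathlen_cat; case: abs => _ /eqP ->.
have half s : itv_partition a b s ->
    ((pathlen g a s)%:E + length b c g <= length a c g)%E.
  move=> abs; rewrite -leeBrDl//; rewrite [X in (X <= _)%E]lengthE.
  by apply/ereal_supP => _ [t bct <-]; rewrite leeBrDl//; exact: key.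
have bcf : length b c g \is a fin_num.
  rewrite ge0_fin_numE ?length_ge0//.
  have [s abs] : exists s, itv_partition a b s.
    move: ab; rewrite le_eqVlt => /predU1P[->|ab]; first by exists [::].
    by exists [:: b]; exact: itv_partition1.
  have := half _ abs; rewrite -leeBrDl// => /le_lt_trans; apply.
  by rewrite -(fineK acf) -EFinB ltry.
rewrite -leeBrDr// [X in (X <= _)%E]lengthE.
by apply/ereal_supP => _ [s abs <-]; rewrite leeBrDr//; exact: half.
Qed.

Lemma length_le_add g a b c : a <= b -> b <= c ->
  (length a c g <= length a b g + length b c g)%E.
Proof.
move=> ab bc; rewrite lengthE; apply/ereal_supP => _ [s acs <-].
elim: s a ab acs => [|t s IH] a ab acs.
  by rewrite /= adde_ge0// length_ge0.
have tcs := itv_partition_cons acs.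
have at_ : a < t by case: acs => /= /andP[].
rewrite /= EFinD; have [tb|bt] := leP t b.
  have := IH _ tb tcs => /(leeD2l (hdist (g a) (g t))%:E) /le_trans; apply.
  rewrite addeA leeD2r//; apply: le_trans (le_length_add g (ltW at_) tb).
  by rewrite leeD2r// hdist_le_length// ltW.
(* The first node t lies beyond b; the triangle inequality inserts b before it. *)
have bcs : itv_partition b c (t :: s) by case: acs => /= /andP[_ ts] sc; split=> //=; rewrite bt.
have := pathlen_le_length g bcs; rewrite /= EFinD => h.
apply: (@le_trans _ _ ((hdist (g a) (g b))%:E +
    ((hdist (g b) (g t))%:E + (pathlen g t s)%:E))%E).
  by rewrite addeA leeD2r// -EFinD lee_fin hdist_triangle.
by apply: leeD => //; exact: hdist_le_length.
Qed.

Lemma le_length_le g a b c : a <= b -> b <= c ->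
  (length a b g <= length a c g)%E.
Proof.
move=> ab bc; apply: le_trans (le_length_add g ab bc).
by rewrite leeDl// length_ge0.
Qed.

Lemma within_itv_hdist g a b u (e : R) : {within `[a, b], continuous g} ->
  a <= u <= b -> 0 < e -> exists2 d, 0 < d &
    forall w, a <= w <= b -> `|u - w| < d -> hdist (g u) (g w) < e.
Proof.
move=> cg aub e0.
have uab : `[a, b]%classic u by rewrite /= in_itv.
have : nbhs (u : subspace `[a, b]) (g @^-1` ball (g u) e).
  by apply: (cg u); exact: nbhsx_ballx.
rewrite /nbhs/= -(nbhs_subspace_in uab) /within/= => /nbhs_ballP[d/= d0 dP].
exists d => // w awb uw; have := dP w uw; rewrite in_itv/= => /(_ awb).
by rewrite /= hballE.
Qed.

(** Some subdivision of [a, u] already has sum above M. Its last node u is moved to a nearby w on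
    the left, still beyond the previous node; by continuity of g the sum changes by less than the
    excess over M. *)
Lemma length_lsc_left g a b u (M : R) : {within `[a, b], continuous g} ->
  a < u <= b -> (M%:E < length a u g)%E ->
  exists2 w, a <= w < u & (M%:E < length a w g)%E.
Proof.
move=> cg /andP[au ub]; rewrite lengthE => /ereal_sup_gt[_ [s aus <-]].
rewrite lte_fin => Ms.
case/lastP: s aus Ms => [/itv_partition_nil|s t] aus.
  by move: au; rewrite aus ltxx.
have [tu svt avs] : [/\ t = u, last a s < u & path <%O a s].
  by case: aus; rewrite rcons_path last_rcons => /andP[-> lt] /eqP <-.
have av : a <= last a s by apply: (@itv_partition_le _ _ _ _ s); split.
rewrite tu pathlen_rcons; set v := last a s in svt av * => Ms.
have e0 : 0 < pathlen g a s + hdist (g v) (g u) - M by rewrite subr_gt0.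
have aub : a <= u <= b by rewrite (ltW au).
have [d d0 dP] := within_itv_hdist cg aub e0.
pose w := Num.max ((v + u) / 2) (u - d / 2).
have vw : v < w by rewrite lt_max midf_lt.
have wu : w < u by rewrite gt_max midf_lt//=; lra.
have uwd : `|u - w| < d.
  rewrite gtr0_norm ?subr_gt0//.
  have : u - d / 2 <= w by rewrite le_max lexx orbT.
  lra.
exists w; first by rewrite wu (le_trans av)// ltW.
have aws : itv_partition a w (rcons s w).
  by split; rewrite ?last_rcons// rcons_path avs.
apply: lt_le_trans (pathlen_le_length g aws).
rewrite pathlen_rcons -/v lte_fin.
have := dP w; rewrite (le_trans (le_trans av (ltW vw)))// (le_trans (ltW wu))//.
move=> /(_ isT uwd); have := hdist_triangle (g w) (g v) (g u).
rewrite (hdist_sym (g w) (g u)); lra.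
Qed.

Lemma length_lsc_right g a b u (M : R) : {within `[a, b], continuous g} ->
  a <= u < b -> (M%:E < length u b g)%E ->
  exists2 w, u < w <= b & (M%:E < length w b g)%E.
Proof.
move=> cg /andP[au ub]; rewrite lengthE => /ereal_sup_gt[_ [s ubs <-]].
rewrite lte_fin => Ms.
case: s ubs Ms => [/itv_partition_nil|v s] ubs.
  by move: ub; rewrite ubs ltxx.
have uv : u < v by case: ubs => /= /andP[].
have vbs := itv_partition_cons ubs.
have vb := itv_partition_le vbs.
rewrite /= => Ms.
have e0 : 0 < hdist (g u) (g v) + pathlen g v s - M by rewrite subr_gt0.
have aub : a <= u <= b by rewrite au ltW.
have [d d0 dP] := within_itv_hdist cg aub e0.
pose w := Num.min ((u + v) / 2) (u + d / 2).
have wv : w < v by rewrite gt_min midf_lt.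
have uw : u < w by rewrite lt_min midf_lt//=; lra.
have uwd : `|u - w| < d.
  rewrite ltr0_norm ?subr_lt0//.
  have : w <= u + d / 2 by rewrite ge_min lexx orbT.
  lra.
exists w; first by rewrite uw (le_trans (ltW wv)).
have wbs : itv_partition w b (v :: s).
  by case: vbs => vs sb; split=> //=; rewrite wv.
apply: lt_le_trans (pathlen_le_length g wbs).
rewrite /= lte_fin.
have := dP w; rewrite (le_trans au (ltW uw)) (le_trans (ltW wv) vb).
move=> /(_ isT uwd); have := hdist_triangle (g w) (g u) (g v).
lra.
Qed.

Section arclength.
Variables (g : R -> heis R) (a b : R).
Hypotheses (ab : a <= b) (cg : {within `[a, b], continuous g}).
Hypothesis fin : (length a b g < +oo)%E.

Let l := fine (length a b g).

Let lE : length a b g = l%:E.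
Proof. by rewrite fineK// ge0_fin_numE// length_ge0. Qed.

(** An intermediate value argument that uses semicontinuity only: u is the last parameter up to
    which the length is at most s. A length above s at u would persist slightly to the left, by
    [length_lsc_left]. A length below s means that more than l - s is left on [u, b]; by
    [length_lsc_right] this persists slightly to the right, so u would not be the supremum. *)
Lemma arclength_attained s : 0 <= s <= l ->
  exists2 u, a <= u <= b & length a u g = s%:E.
Proof.
move=> /andP[s0 sl].
pose S := [set w | a <= w <= b /\ (length a w g <= s%:E)%E].
have Sa : S a by split; [rewrite lexx|rewrite lengthxx lee_fin].
have Sb : ubound S b by move=> w [/andP[]].
have supS : has_sup S by split; [exists a|exists b].
pose u := sup S.
have au : a <= u by exact: sup_upper_bound.
have ub : u <= b by apply: ge_sup => //; exists a.
have aub : a <= u <= b by rewrite au.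
exists u => //; apply/le_anti/andP; split.
  rewrite leNgt; apply/negP => su.
  have au' : a < u.
    rewrite lt_neqAle au andbT; apply/eqP => E; move: su; rewrite -E lengthxx.
    by rewrite lte_fin ltNge s0.
  have [w /andP[aw wu] sw] := @length_lsc_left g a b u s cg (introT andP (conj au' ub)) su.
  have [w' [/andP[aw' w'b] Sw'] ww'] := sup_gt (ex_intro _ a Sa) wu.
  have := le_length_le g aw (ltW ww').
  by move=> /le_trans/(_ Sw'); rewrite leNgt sw.
rewrite leNgt; apply/negP => us.
have auf : length a u g = (fine (length a u g))%:E.
  by rewrite fineK// ge0_fin_numE ?length_ge0// (lt_trans us)// ltry.
have ub' : u < b.
  rewrite lt_neqAle ub andbT; apply/eqP => E; move: us.
  by rewrite E lE lte_fin ltNge sl.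
have lu : ((l - s)%:E < length u b g)%E.
  have := length_le_add g au ub; rewrite lE.
  move: us; rewrite auf lte_fin => us.
  move=> /(lt_le_trans _); have : ((l - s)%:E + (fine (length a u g))%:E < l%:E)%E.
    by rewrite -EFinD lte_fin; lra.
  by move=> + h => /h; rewrite addeC lteD2lE.
have [w /andP[uw wb] lw] := length_lsc_right cg (introT andP (conj au ub')) lu.
have : S w.
  have aw := le_trans au (ltW uw).
  split; first by rewrite aw.
  have := le_length_add g aw wb; rewrite lE leNgt => h.
  rewrite leNgt; apply/negP => sw; move/negP: h; apply.
  by have := lteD sw lw; rewrite -EFinD addrC subrK.
by move=> /(sup_upper_bound supS); rewrite leNgt uw.
Qed.

Let sigma := arclength_param a b g.

Lemma arclength_paramP s : 0 <= s <= l ->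
  exists u, [/\ a <= u <= b, length a u g = s%:E & sigma s = g u].
Proof.
move=> /arclength_attained[u aub us].
rewrite /sigma /arclength_param; case: xgetP => [w _ [/=]|/(_ u)[]//].
by rewrite in_itv/= => awb ws; exists w.
Qed.

Lemma arclength_param_lipschitz s t : 0 <= s -> s <= t -> t <= l ->
  hdist (sigma s) (sigma t) <= t - s.
Proof.
move=> s0; rewrite le_eqVlt => /predU1P[<- _|st tl].
  by rewrite hdistxx subrr.
have [|u [/andP[au ub] Lu ->]] := @arclength_paramP s.
  by rewrite s0 (le_trans (ltW st)).
have [|w [/andP[aw wb] Lw ->]] := @arclength_paramP t.
  by rewrite tl (le_trans s0 (ltW st)).
have uw : u <= w.
  rewrite leNgt; apply/negP => wu; have := le_length_le g aw (ltW wu).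
  by rewrite Lu Lw lee_fin leNgt st.
have := le_length_add g au uw; rewrite Lu Lw => h.
rewrite lerBrDl -lee_fin; apply: le_trans h.
by rewrite EFinD leeD2l// hdist_le_length.
Qed.

Lemma arclength_param0 : sigma 0 = g a.
Proof.
have [|u [/andP[au ub] Lu ->]] := @arclength_paramP 0.
  by rewrite lexx -lee_fin -lE length_ge0.
apply/esym/hdist_positivity/le_anti; rewrite hdist_ge0 andbT.
by rewrite -lee_fin -Lu hdist_le_length.
Qed.

Lemma arclength_param_end : sigma l = g b.
Proof.
have [|u [/andP[au ub] Lu ->]] := @arclength_paramP l.
  by rewrite lexx -lee_fin -lE length_ge0.
apply/hdist_positivity/le_anti; rewrite hdist_ge0 andbT.
have := le_length_add g au ub; rewrite Lu lE => h.
have : (l%:E + (hdist (g u) (g b))%:E <= l%:E)%E.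
  by apply: le_trans h; rewrite leeD2l// hdist_le_length.
by rewrite -EFinD lee_fin gerDl.
Qed.

End arclength.
End length_theory.

(** * The modulus *)

(* Unlike [ge0_le_integral] of the library, without measurability: for a
   nonnegative function the integral is a supremum over simple functions. *)
Lemma ge0_integral_mono d (T : measurableType d) (R : realType)
    (mu : {measure set T -> \bar R}) (D : set T) (f g : T -> \bar R) :
  (forall x, D x -> 0 <= f x)%E -> (forall x, D x -> f x <= g x)%E ->
  (\int[mu]_(x in D) f x <= \int[mu]_(x in D) g x)%E.
Proof.
move=> f0 fg.
have g0 x : D x -> (0 <= g x)%E by move=> Dx; exact: le_trans (f0 _ Dx) (fg _ Dx).
rewrite !ge0_integralE//; apply: ereal_sup_le => _ [h hf <-]; exists h => //= x.
by apply: le_trans (hf x) _; exact: lee_restrict.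
Qed.

(** * Boxes of known volume around Heisenberg balls *)

Section modulus.
Context {R : realType}.
Implicit Types (o p q : heis R).

Local Notation T3 := (measurableTypeR R * measurableTypeR R * measurableTypeR R)%type.

(** The left translate by o of the box |x| < r, |y| < r, |t| < r^2. In the coordinates of p the
    translation acts as a shift followed by a shear in t, which keeps the volume of the box. *)
Definition hbox o (r : R) : set T3 :=
  [set p | [/\ `|p.1.1 - o.1.1| < r, `|p.1.2 - o.1.2| < r &
     `|p.2 - (o.2 + 2 * (o.1.2 * p.1.1 - o.1.1 * p.1.2))| < r ^+ 2]].

Lemma hnorm_coord (x y t : R) :
  [/\ `|x| <= hnorm (x, y, t), `|y| <= hnorm (x, y, t) &
      `|t| <= hnorm (x, y, t) ^+ 2].
Proof.
have N0 := hnorm_ge0 (x, y, t); have := hnorm4 x y t.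
move: (hnorm _) N0 => N N0 E.
have s0 : 0 <= x ^+ 2 + y ^+ 2 by rewrite addr_ge0 ?sqr_ge0.
have N20 : 0 <= N ^+ 2 by rewrite sqr_ge0.
have sN : x ^+ 2 + y ^+ 2 <= N ^+ 2.
  rewrite -(@ler_pXn2r _ 2)// ?nnegrE// -exprM E lerDl sqr_ge0//.
split; rewrite -(@ler_pXn2r _ 2)// ?nnegrE// real_normK ?num_real//.
- by apply: le_trans sN; rewrite lerDl sqr_ge0.
- by apply: le_trans sN; rewrite lerDr sqr_ge0.
- by rewrite -exprM E lerDr sqr_ge0.
Qed.

Lemma ball_sub_hbox o (r : R) : ball o r `<=` hbox o r.
Proof.
move: o => [[x0 y0] t0] [[x y] t]; rewrite hballE.
pose N := hnorm (x - x0, y - y0, t - (t0 + 2 * (y0 * x - x0 * y))).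
have -> : [set q | hdist (x0, y0, t0) q < r] (x, y, t) = (N < r).
  by rewrite /= /N; congr (hnorm _ < r); congr (_, _, _); ring.
move=> Nr; have [hX hY hT] := hnorm_coord (x - x0) (y - y0) (t - (t0 + 2 * (y0 * x - x0 * y))).
have r0 : 0 <= r by apply: le_trans (ltW Nr); exact: hnorm_ge0.
split => /=; [exact: le_lt_trans Nr|exact: le_lt_trans Nr|].
by apply: le_lt_trans hT _; rewrite ltr_pXn2r// nnegrE// hnorm_ge0.
Qed.

Lemma measurable_hbox o (r : R) : measurable (hbox o r).
Proof.
pose f1 (p : T3) : R := p.1.1 - o.1.1.
pose f2 (p : T3) : R := p.1.2 - o.1.2.
pose f3 (p : T3) : R := p.2 - (o.2 + 2 * (o.1.2 * p.1.1 - o.1.1 * p.1.2)).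
have m11 : measurable_fun [set: T3] (fun p : T3 => p.1.1 : R).
  by apply: measurableT_comp; [exact: measurable_fst|exact: measurable_fst].
have m12 : measurable_fun [set: T3] (fun p : T3 => p.1.2 : R).
  by apply: measurableT_comp; [exact: measurable_snd|exact: measurable_fst].
have m1 : measurable_fun setT f1 by exact: measurable_funB.
have m2 : measurable_fun setT f2 by exact: measurable_funB.
have m3 : measurable_fun setT f3.
  apply: measurable_funB; first exact: measurable_snd.
  apply: measurable_funD => //; apply: measurable_funM => //.
  by apply: measurable_funB; apply: measurable_funM.
have key (f : T3 -> R) (e : R) : measurable_fun setT f ->
    measurable [set p | `|f p| < e].
  move=> mf; have -> : [set p | `|f p| < e] = setT `&` f @^-1` `]-e, e[%classic.
    by apply/seteqP; split=> p /=; rewrite in_itv/= ltr_norml// => -[].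
  by apply: mf => //; exact: measurable_itv.
have -> : hbox o r = [set p | `|f1 p| < r] `&` [set p | `|f2 p| < r] `&`
    [set p | `|f3 p| < r ^+ 2].
  by apply/seteqP; split=> p /= [[]].
by apply: measurableI; [apply: measurableI|]; exact: key.
Qed.

Lemma lebesgue_measure_dist_lt (c e : R) : 0 <= e ->
  lebesgue_measure ([set x : measurableTypeR R | `|x - c| < e]) = (2 * e)%:E.
Proof.
move=> e0; have -> : [set x : measurableTypeR R | `|x - c| < e] = `]c - e, c + e[%classic.
  apply/seteqP; split=> x /=; rewrite in_itv/= ltr_norml => /andP[? ?];
  by apply/andP; split; lra.
rewrite lebesgue_measure_itv/= lte_fin; case: ifPn => h.
  by rewrite -EFinB; congr EFin; ring.
by congr EFin; lra.
Qed.

Lemma lebesgue3_hbox o (r : R) : 0 <= r ->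
  lebesgue3 (hbox o r) = (8 * r ^+ 4)%:E.
Proof.
move=> r0; rewrite /lebesgue3.
pose Q : set (measurableTypeR R * measurableTypeR R) :=
  [set x | `|x - o.1.1| < r] `*` [set y | `|y - o.1.2| < r].
have mI (c e : R) : measurable ([set x : measurableTypeR R | `|x - c| < e]).
  have -> : [set x : measurableTypeR R | `|x - c| < e] = `]c - e, c + e[%classic.
    apply/seteqP; split=> x /=; rewrite in_itv/= ltr_norml => /andP[? ?];
    by apply/andP; split; lra.
  exact: measurable_itv.
have mQ : measurable Q by exact: measurableX.
(* Over a point z of the square Q the section is an interval of length 2 r^2, with a centre that
   depends on z; elsewhere it is empty. *)
transitivity (\int[lebesgue_measure \x lebesgue_measure]_z
    ((2 * r ^+ 2)%:E * (\1_Q z)%:E))%E.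
  apply: eq_integral => z _ /=; rewrite indicE.
  have [zQ|zQ] := boolP (z \in Q).
    rewrite mule1 -(@lebesgue_measure_dist_lt (o.2 + 2 * (o.1.2 * z.1 - o.1.1 * z.2))) ?sqr_ge0//.
    congr (lebesgue_measure _); apply/seteqP; split=> t.
      by move/xsectionP => [].
    by move=> tt; apply/xsectionP; move: zQ; rewrite inE => -[z1 z2]; split.
  rewrite mule0 (_ : xsection _ _ = set0) ?measure0//.
  rewrite -subset0 => t /xsectionP[/= z1 z2 _].
  by move: zQ; rewrite notin_setE; apply.
rewrite ge0_integralZl//; last 2 first.
- exact/measurable_EFinP/measurable_indic.
- by rewrite lee_fin mulr_ge0// sqr_ge0.
have muQ : (lebesgue_measure \x lebesgue_measure)%E Q = ((2 * r)%:E * (2 * r)%:E)%E.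
  by rewrite product_measure1E//; congr (_ * _)%E; exact: lebesgue_measure_dist_lt.
transitivity ((2 * r ^+ 2)%:E * (lebesgue_measure \x lebesgue_measure)%E Q)%E.
  by congr (_ * _)%E; rewrite integral_indic// setIT.
by rewrite muQ -!EFinM; congr EFin; ring.
Qed.

End modulus.

Section modulus_bound.
Context {R : realType}.

(* The test function is [\sum_j c j * \1_(A j)]; its arc-length integral over a
   curve of the family is at least n times 1/n. *)
Lemma Mod4_le_sum (G : set (curve (R := R))) (n : nat) (A : 'I_n -> set (heis R))
    (c r : 'I_n -> R) (o : heis R) :
  (0 < n)%N -> (forall j, open (A j)) ->
  (forall i j, i != j -> A i `&` A j = set0) ->
  (forall j, 0 <= r j) -> (forall j, A j `<=` ball o (r j)) ->
  (forall j, 0 <= c j) ->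
  (forall C, G C -> exists a b, [/\ a <= b, cdom C = `[a, b],
     (length a b C < +oo)%E & forall j, exists s t,
       [/\ 0 <= s, s <= t, t <= fine (length a b C), n%:R^-1 <= c j * (t - s) &
        forall u, s < u < t -> A j (arclength_param a b C u)]]) ->
  (Mod4 G <= (\sum_j c j ^+ 4 * (8 * r j ^+ 4))%:E)%E.
Proof.
move=> n0 oA dA r0 Ar c0 GA.
pose rho (p : heis R) : R := \sum_j c j * \1_(A j) p.
have rho0 p : 0 <= rho p by apply: sumr_ge0 => j _; rewrite mulr_ge0// indicE.
apply: ge_ereal_inf; exists (\int[lebesgue3]_p ((rho p)%:E ^+ 4))%E.
  exists (fun p => (rho p)%:E) => //; split.
  - apply/measurable_EFinP.
    apply: (@measurable_sum _ (g_sigma_algebraType (@open (heis R)))) => j.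
    apply: measurable_funM => //; apply: measurable_indic.
    exact: sub_sigma_algebra.
  - by move=> p; rewrite lee_fin.
  - move=> C /GA [a [b [ab Cab fin hit]]] _.
    apply: le_ereal_sup_tmp; exists (line_integral_itv a b C (fun p => (rho p)%:E)).
      by exists a, b; split=> //; rewrite Cab in_itv/= ?lexx ?ab.
    have [s sP] := choice hit; have {sP}[t stP] := choice sP.
    rewrite /line_integral_itv.
    set l := fine _; set sg := arclength_param a b C.
    pose I j : set (measurableTypeR R) := `]s j, t j[%classic.
    have mI j : measurable (I j) by exact: measurable_itv.
    (* For each j the curve lies in [A j] on [I j], so the integrand dominates this step function,
       which can be integrated term by term. *)
    apply: (@le_trans _ _ (\int[lebesgue_measure]_(u in `[0%R, l])
        \sum_j ((c j)%:E * (\1_(I j) u)%:E))%E); last first.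
      apply: ge0_integral_mono => u _.
        by apply: sume_ge0 => j _; rewrite mule_ge0// lee_fin// indicE.
      rewrite /rho -sumEFin; apply: lee_sum => j _; rewrite -EFinM lee_fin.
      rewrite ler_wpM2l// !indicE; have [uI|//] := boolP (u \in I j).
      have [_ _ _ _ /(_ u)] := stP j.
      by move: uI; rewrite inE /I/= in_itv/= => uI /(_ uI) Au; rewrite mem_set.
    rewrite ge0_integral_sum//; last 2 first.
    - by move=> j; apply: emeasurable_funM => //; exact/measurable_EFinP/measurable_indic.
    - by move=> j u _; rewrite mule_ge0// lee_fin// indicE.
    apply: (@le_trans _ _ (\sum_(j < n) (n%:R^-1)%:E)%E).
      rewrite sumEFin sumr_const card_ord lee_fin -[leRHS]mulr_natr mulVf//.
      by rewrite pnatr_eq0 -lt0n.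
    apply: lee_sum => j _; have [s0 st tl ct _] := stP j.
    rewrite ge0_integralZl//; last 2 first.
    - exact/measurable_EFinP/measurable_indic.
    - by rewrite lee_fin.
    rewrite integral_indic//.
    have -> : I j `&` `[0, l] = I j.
      apply/setIidPl => u; rewrite /I /= !in_itv/= => /andP[su ut].
      by rewrite (le_trans s0 (ltW su)) (le_trans (ltW ut) tl).
    have muI : lebesgue_measure (I j) = (t j - s j)%:E.
      rewrite /I lebesgue_measure_itv/= lte_fin; case: ifPn => [_|h].
        by rewrite -EFinB.
      by congr EFin; apply/esym/eqP; rewrite subr_eq0 eq_le st andbT leNgt.
    apply: (@le_trans _ _ ((c j)%:E * lebesgue_measure (I j))%E); last exact: lexx.
    by rewrite muI -EFinM lee_fin.
(* The [A j] are disjoint, so at most one term of [rho p] is nonzero and the fourth power of the sum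
   is the sum of the fourth powers. Then each [A j] is enlarged to a box of known volume. *)
apply: (@le_trans _ _ (\int[lebesgue3]_p
    \sum_j ((c j ^+ 4)%:E * (\1_(hbox o (r j)) p)%:E))%E).
  apply: ge0_integral_mono => p _; first by rewrite -EFin_expe lee_fin exprn_ge0.
  rewrite -EFin_expe.
  have tot0 j : (0 <= (c j ^+ 4)%:E * (\1_(hbox o (r j)) p)%:E)%E.
    by rewrite -EFinM lee_fin mulr_ge0 ?exprn_ge0// indicE.
  have [[i Ai]|none] := pselect (exists i, A i p); last first.
    rewrite /rho big1 ?expr0n/=; first by apply: sume_ge0.
    by move=> j _; rewrite indicE memNset ?mulr0// => Aj; apply: none; exists j.
  have -> : rho p = c i.
    rewrite /rho (bigD1 i)//= big1 ?addr0.
      by rewrite indicE mem_set// mulr1.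
    move=> j ji; rewrite indicE memNset ?mulr0// => Aj.
    have : (A j `&` A i) p by [].
    by rewrite dA.
  rewrite (bigD1 i)//= indicE mem_set ?mule1; last exact/ball_sub_hbox/Ar.
  by rewrite leeDl//; apply: sume_ge0.
rewrite /lebesgue3 ge0_integral_sum//; last 2 first.
- move=> j; apply: emeasurable_funM => //.
  by apply/measurable_EFinP/measurable_indic; exact: measurable_hbox.
- by move=> j p _; rewrite -EFinM lee_fin mulr_ge0 ?exprn_ge0// indicE.
rewrite -sumEFin; apply: lee_sum => j _.
rewrite ge0_integralZl//; last 2 first.
- by apply/measurable_EFinP/measurable_indic; exact: measurable_hbox.
- by rewrite lee_fin exprn_ge0.
rewrite integral_indic//; last exact: measurable_hbox.
rewrite setIT.
(* This only folds [lebesgue3] back; both sides are convertible. *)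
apply: (@le_trans _ _ ((c j ^+ 4)%:E * lebesgue3 (hbox o (r j)))%E).
  exact: lexx.
by rewrite lebesgue3_hbox// -EFinM.
Qed.

End modulus_bound.

(** * Modulus of curves joining two sets *)

Section joining.
Context {R : realType}.
Implicit Types (E F K O : set (heis R)) (o p q : heis R).

Lemma hdist_lip o p q : `|hdist o p - hdist o q| <= hdist p q.
Proof.
rewrite ler_norml lerBlDr; have := hdist_triangle p o q; have := hdist_triangle q o p.
rewrite (hdist_sym q p) => h1 h2; apply/andP; split; lra.
Qed.

Lemma hdist_continuous o : continuous (hdist o : heis R -> R).
Proof.
move=> p A /nbhs_ballP[e /= e0 eA]; apply/nbhs_ballP; exists e => // q.
rewrite hballE/= => pq; apply: eA.
by apply: le_lt_trans pq; exact: hdist_lip.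
Qed.

Lemma open_annulus o (s t : R) : open [set p | s < hdist o p < t].
Proof.
have -> : [set p | s < hdist o p < t] = hdist o @^-1` `]s, t[%classic.
  by apply/seteqP; split=> p; rewrite /= in_itv.
apply: open_comp; last exact: itv_open.
by move=> p _; exact: hdist_continuous.
Qed.

Lemma open_hball o (r : R) : open (ball o r).
Proof.
have -> : ball o r = hdist o @^-1` [set t | t < r] by rewrite hballE.
apply: open_comp; last exact: open_lt.
by move=> p _; exact: hdist_continuous.
Qed.

(** The test function is 1/d on the ball of radius r + d. Every joining curve has length at least d
    and starts in the ball of radius r, so its first piece of length d stays in the larger ball. *)
Lemma Mod4_joining_lty E F O o (r d : R) : 0 < d -> 0 <= r ->
  (forall p q, E p -> F q -> d <= hdist p q) ->
  E `<=` ball o r -> F `<=` ball o r -> (Mod4_joining E F O < +oo)%E.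
Proof.
move=> d0 r0 dEF Er Fr.
apply: (@le_lt_trans _ _ (\sum_(j < 1) d^-1 ^+ 4 * (8 * (r + d) ^+ 4))%:E); last exact: ltry.
apply: (@Mod4_le_sum _ _ 1 (fun=> ball o (r + d)) (fun=> d^-1) (fun=> r + d) o) => //.
- by move=> _; exact: open_hball.
- by move=> i j; rewrite !ord1 eqxx.
- by move=> _; rewrite addr_ge0// ltW.
- by move=> _ p.
- by move=> _; rewrite invr_ge0 ltW.
- move=> C [a [b [ab Cab fin _ EF]]]; exists a, b; split=> // _.
  have cC : {within `[a, b], continuous C} by rewrite -Cab; exact: cmap_continuous.
  have lE : length a b C = (fine (length a b C))%:E.
    by rewrite fineK// ge0_fin_numE// length_ge0.
  have dl : d <= fine (length a b C).
    rewrite -lee_fin -lE; apply: le_trans (hdist_le_length C ab).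
    by rewrite lee_fin; case: EF => -[h1 h2]; [|rewrite hdist_sym]; exact: dEF.
  exists 0, d; split=> //; first exact: ltW.
    by rewrite subr0 mulVf ?gt_eqF// invr1.
  move=> u /andP[u0 ud].
  have oCa : ball o r (C a) by case: EF => -[h _]; [exact: Er|exact: Fr].
  have := arclength_param_lipschitz ab cC fin (lexx 0) (ltW u0) (le_trans (ltW ud) dl).
  rewrite arclength_param0// subr0 => Cu.
  move: oCa; rewrite !hballE /= => oCa.
  by apply: le_lt_trans (hdist_triangle (C a) _ _) _; lra.
Qed.

(** Here s is the last time at which f is at most [al], and t the first time after s at which f is
    at least [be]. The Lipschitz bound shows that both are attained and that passing from one value
    to the other takes time at least [be - al]. *)
Lemma lipschitz_crossing (f : R -> R) (l al be : R) :
  (forall s t, 0 <= s -> s <= t -> t <= l -> `|f s - f t| <= t - s) -> 0 <= l ->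
  al <= be -> f 0 <= al -> be <= f l ->
  exists s t, [/\ 0 <= s, s <= t, t <= l, be - al <= t - s &
    forall w, s < w < t -> al < f w < be].
Proof.
move=> lip l0 ab f0 fl.
have lip1 s t : 0 <= s -> s <= t -> t <= l -> f t <= f s + (t - s).
  by move=> s0 st tl; have := lip s t s0 st tl; rewrite ler_norml => /andP[]; lra.
pose S := [set w | 0 <= w <= l /\ f w <= al].
have S0 : S 0 by rewrite /S /= lexx l0.
have supS : has_sup S by split; [exists 0|exists l => w [/andP[]]].
pose s := sup S.
have s0 : 0 <= s by exact: sup_upper_bound.
have sl : s <= l by apply: ge_sup; [exists 0|move=> w [/andP[]]].
have fs : f s <= al.
  rewrite leNgt; apply/negP => als.
  have e0 : 0 < f s - al by rewrite subr_gt0.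
  have [w Sw] := sup_adherent e0 supS; rewrite -/s => sw.
  have ws : w <= s by exact: sup_upper_bound.
  case: Sw => /andP[w0 wl] fw; have := lip1 w s w0 ws sl; lra.
have s_above w : s < w -> w <= l -> al < f w.
  move=> sw wl; rewrite ltNge; apply/negP => fw.
  have : S w by split=> //; rewrite wl andbT (le_trans s0 (ltW sw)).
  by move=> /(sup_upper_bound supS); rewrite leNgt sw.
pose T := [set w | s <= w <= l /\ be <= f w].
have Tl : T l by rewrite /T /= lexx sl.
have infT : has_inf T by split; [exists l|exists s => w [/andP[]]].
pose t := inf T.
have st : s <= t by apply: lb_le_inf; [exists l|move=> w [/andP[]]].
have tl : t <= l by apply: ge_inf => //; case: infT.
have ft : be <= f t.
  rewrite leNgt; apply/negP => tbe.
  have e0 : 0 < be - f t by rewrite subr_gt0.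
  have [w Tw] := inf_adherent e0 infT; rewrite -/t => wt.
  have tw : t <= w by apply: ge_inf => //; case: infT.
  case: Tw => /andP[sw wl] fw; have := lip1 t w (le_trans s0 st) tw wl; lra.
exists s, t; split=> //.
  by have := lip1 s t s0 st tl; lra.
move=> w /andP[sw wt]; rewrite s_above//=; last exact: le_trans (ltW wt) tl.
rewrite ltNge; apply/negP => fw.
have : T w by split=> //; rewrite (ltW sw) (le_trans (ltW wt) tl).
move=> Tw; have : t <= w by apply: ge_inf => //; case: infT.
by rewrite leNgt wt.
Qed.

(** The annulus between radii r / 2^(j+1) and r / 2^j has width r / 2^(j+1), so the weight 2^(j+1) /
    (n r) collects 1/n on each crossing. Its contribution is the fourth power of the weight times 8
    (r / 2^j)^4, that is 2^4 * 8 / n^4 = 128 / n^4 for every j. *)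
Lemma Mod4_joining_ring E K O o (r : R) (n : nat) : (0 < n)%N -> 0 < r ->
  (forall p, E p -> hdist o p <= r / 2 ^+ n) -> (forall p, K p -> r <= hdist o p) ->
  (Mod4_joining E K O <= (128 / n%:R ^+ 3)%:E)%E.
Proof.
move=> n0 r0 Er Kr.
have nR0 : 0 < n%:R :> R by rewrite ltr0n.
have p2 k : 0 < 2 ^+ k :> R by rewrite exprn_gt0.
have half_le (j k : nat) : (j <= k)%N -> r / 2 ^+ k <= r / 2 ^+ j.
  by move=> jk; rewrite ler_pM2l// lef_pV2 ?posrE// ler_eXn2l// ltr1n.
have -> : (128 / n%:R ^+ 3 = \sum_(j < n) (2 ^+ j.+1 / (n%:R * r)) ^+ 4 * (8 * (r / 2 ^+ j) ^+ 4))%R.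
  rewrite (eq_bigr (fun=> 128 / n%:R ^+ 4)); last first.
    move=> j _; rewrite (exprS 2 j).
    by have := p2 j; move: (2 ^+ j) => c c0; field; rewrite !gt_eqF.
  by rewrite sumr_const card_ord -[RHS]mulr_natr; field; rewrite gt_eqF.
apply: (@Mod4_le_sum _ _ n (fun j => [set p | r / 2 ^+ j.+1 < hdist o p < r / 2 ^+ j])
  (fun j => 2 ^+ j.+1 / (n%:R * r)) (fun j => r / 2 ^+ j) o) => //.
- by move=> j; exact: open_annulus.
- have lem (i j : 'I_n) p : (i < j)%N -> r / 2 ^+ i.+1 < hdist o p ->
      hdist o p < r / 2 ^+ j -> False.
    move=> ij h1 h2; have := half_le _ _ ij; lra.
  move=> i j ij; rewrite -subset0 => p [/= /andP[h1 h2] /andP[h3 h4]].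
  have [h|h|h] := ltngtP i j; [exact: lem h h1 h4|exact: lem h h3 h2|].
  by move: ij; rewrite (ord_inj h) eqxx.
- by move=> j; rewrite divr_ge0// ltW.
- by move=> j p /= /andP[_]; rewrite hballE.
- by move=> j; rewrite divr_ge0 ?mulr_ge0// ltW.
- move=> C [a [b [ab Cab fin _ EK]]]; exists a, b; split=> // j.
  have cC : {within `[a, b], continuous C} by rewrite -Cab; exact: cmap_continuous.
  set l := fine _; pose sg := arclength_param a b C.
  have lE : length a b C = l%:E by rewrite fineK// ge0_fin_numE// length_ge0.
  have l0 : 0 <= l by rewrite -lee_fin -lE length_ge0.
  have lip s t : 0 <= s -> s <= t -> t <= l ->
      `|hdist o (sg s) - hdist o (sg t)| <= t - s.
    move=> s0 st tl; apply: le_trans (hdist_lip _ _ _) _.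
    exact: arclength_param_lipschitz.
  have jn : r / 2 ^+ n <= r / 2 ^+ j.+1 by apply: half_le.
  have j0 : r / 2 ^+ j <= r by have := half_le 0 j isT; rewrite expr0 divr1.
  have jj : r / 2 ^+ j.+1 <= r / 2 ^+ j by apply: half_le.
  have cj (s t : R) : r / 2 ^+ j - r / 2 ^+ j.+1 <= t - s ->
      n%:R^-1 <= 2 ^+ j.+1 / (n%:R * r) * (t - s).
    move=> h; apply: (@le_trans _ _ (2 ^+ j.+1 / (n%:R * r) * (r / 2 ^+ j - r / 2 ^+ j.+1))).
      rewrite le_eqVlt; apply/orP; left; apply/eqP; rewrite (exprS 2 j).
      by have := p2 j; move: (2 ^+ j) => c c0; field; rewrite !gt_eqF.
    by rewrite ler_wpM2l// divr_ge0 ?mulr_ge0// ltW.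
  case: EK => -[CA CB].
    have [s [t [s0 st tl h hw]]] : exists s t, [/\ 0 <= s, s <= t, t <= l,
        r / 2 ^+ j - r / 2 ^+ j.+1 <= t - s &
        forall w, s < w < t -> r / 2 ^+ j.+1 < hdist o (sg w) < r / 2 ^+ j].
      apply: (@lipschitz_crossing (fun s => hdist o (sg s))) => //.
        by rewrite /sg arclength_param0//; apply: le_trans jn; exact: Er.
      by rewrite /sg arclength_param_end//; apply: le_trans j0 _; exact: Kr.
    by exists s, t; split=> //; exact: cj.
  (* The curve starts in K and ends in E: the crossing is found on the reversed parameter l - s and
     reflected back. *)
  have [s [t [s0 st tl h hw]]] : exists s t, [/\ 0 <= s, s <= t, t <= l,
      r / 2 ^+ j - r / 2 ^+ j.+1 <= t - s &
      forall w, s < w < t -> r / 2 ^+ j.+1 < hdist o (sg (l - w)) < r / 2 ^+ j].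
    apply: (@lipschitz_crossing (fun s => hdist o (sg (l - s)))) => //.
    - move=> s t s0 st tl; rewrite distrC.
      by have := lip (l - t) (l - s); rewrite (_ : l - s - (l - t) = t - s) ?subr_ge0 ?lerD2l ?lerN2 ?gerBl//; [exact|ring].
    - by rewrite subr0 /sg arclength_param_end//; apply: le_trans jn; exact: Er.
    - by rewrite subrr /sg arclength_param0//; apply: le_trans j0 _; exact: Kr.
  exists (l - t), (l - s); split.
  - by rewrite subr_ge0.
  - by rewrite lerD2l lerN2.
  - by rewrite gerBl.
  - by apply: cj; rewrite (_ : l - s - (l - t) = t - s)//; ring.
  - move=> u /andP[tu us]; have := hw (l - u); rewrite subKr; apply.
    by apply/andP; split; lra.
Qed.

Lemma Mod4_ge0 (G : set (curve (R := R))) : (0 <= Mod4 G)%E.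
Proof.
apply: le_ereal_inf_tmp => _ [rho [_ rho0 _] <-].
by apply: integral_ge0 => p _; rewrite expe_ge0.
Qed.

Lemma Mod4_joining_cvg0 (E : nat -> set (heis R)) K O o (r : R) : 0 < r ->
  (forall e, 0 < e -> \forall k \near \oo, E k `<=` ball o e) ->
  (forall p, K p -> r <= hdist o p) ->
  Mod4_joining (E k) K O @[k --> \oo] --> (0 : \bar R)%E.
Proof.
move=> r0 Eo Kr.
have small (e : R) : 0 < e -> \forall k \near \oo, (Mod4_joining (E k) K O <= e%:E)%E.
  (* This n is at least 1 and exceeds 128 / e, so 128 / n^3 <= 128 / n < e. *)
  move=> e0; pose n := (Num.trunc (128 / e)).+1.
  have ne : 128 / e < n%:R by exact: truncnS_gt.
  have n1 : 1 <= n%:R :> R by rewrite ler1n.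
  have := Eo (r / 2 ^+ n); rewrite divr_gt0 ?exprn_gt0// => /(_ isT).
  apply: filterS => k Ek.
  apply: (@le_trans _ _ (128 / n%:R ^+ 3)%:E).
    by apply: Mod4_joining_ring r0 _ Kr => // p /Ek; rewrite hballE => /ltW.
  rewrite lee_fin ler_pdivrMr ?exprn_gt0 ?(lt_le_trans _ n1)//.
  move: ne; rewrite ltr_pdivrMr// => ne.
  apply: (le_trans (ltW ne)); rewrite mulrC ler_pM2l//.
  by rewrite exprS ler_peMr ?(le_trans _ n1)// exprn_ege1.
have fin : \forall k \near \oo, Mod4_joining (E k) K O \is a fin_num.
  have := small 1 ltr01; apply: filterS => k h.
  by rewrite ge0_fin_numE ?Mod4_ge0// (le_lt_trans h)// ltry.
apply/fine_cvgP; split=> //; apply/cvgrPdist_le => e e0.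
near=> k; have f : Mod4_joining (E k) K O \is a fin_num by near: k.
have h : (Mod4_joining (E k) K O <= e%:E)%E by near: k; exact: small.
by rewrite /= sub0r normrN ger0_norm ?fine_ge0 ?Mod4_ge0// -lee_fin fineK.
Unshelve. all: by end_near.
Qed.

End joining.

(** * Slices of the Koranyi ball *)

Section real_continuity.
Context {R : realType} {T : topologicalType}.
Implicit Types f g : T -> R.

Lemma contD f g : continuous f -> continuous g -> continuous (fun x => f x + g x).
Proof. by move=> cf cg x; apply: cvgD; [exact: cf|exact: cg]. Qed.

Lemma contN f : continuous f -> continuous (fun x => - f x).
Proof. by move=> cf x; apply: cvgN; exact: cf. Qed.

Lemma contM f g : continuous f -> continuous g -> continuous (fun x => f x * g x).
Proof. by move=> cf cg x; apply: cvgM; [exact: cf|exact: cg]. Qed.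

Lemma contX f n : continuous f -> continuous (fun x => f x ^+ n).
Proof.
move=> cf; elim: n => [|n IH].
  by rewrite (_ : (fun _ => _) = cst 1)//; exact: cst_continuous.
rewrite (_ : (fun _ => _) = (fun x => f x * f x ^+ n)); first exact: contM.
by apply/funext => x; rewrite exprS.
Qed.

Lemma contC (c : R) : continuous (fun _ : T => c).
Proof. exact: cst_continuous. Qed.

Lemma open_lt_cont f c : continuous f -> open [set x | f x < c].
Proof. by move=> cf; apply: (@open_comp _ _ f _ _ (@open_lt _ c)) => x _; exact: cf. Qed.

Lemma open_gt_cont f c : continuous f -> open [set x | c < f x].
Proof. by move=> cf; apply: (@open_comp _ _ f _ _ (@open_gt _ c)) => x _; exact: cf. Qed.

Lemma closed_le_cont f c : continuous f -> closed [set x | f x <= c].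
Proof.
move=> cf; rewrite (_ : [set x | _] = ~` [set x | c < f x]).
  exact/open_closedC/open_gt_cont.
by apply/seteqP; split=> x /=; rewrite leNgt => /negP.
Qed.

End real_continuity.

(** * The topology of the Heisenberg distance in coordinates *)

Section heis_topology.
Context {R : realType}.
Implicit Types p q o : heis R.

Definition hx p : R := p.1.1.
Definition hy p : R := p.1.2.
Definition ht p : R := p.2.

Lemma hdist_eq p q : hdist p q ^+ 4 =
  ((hx q - hx p) ^+ 2 + (hy q - hy p) ^+ 2) ^+ 2 +
  (ht q - (ht p + 2 * (hy p * hx q - hx p * hy q))) ^+ 2.
Proof.
move: p q => [[x0 y0] t0] [[x y] t]; rewrite /hx /hy /ht /= -hnorm4.
congr (_ ^+ 4); rewrite /hdist; congr hnorm; congr (_, _, _); ring.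
Qed.

Lemma hx_continuous : continuous (hx : heis R -> R).
Proof.
move=> p A /nbhs_ballP[e /= e0 eA]; apply/nbhs_ballP; exists e => // q.
by move=> /ball_sub_hbox [h _ _]; apply: eA; rewrite /ball/= distrC.
Qed.

Lemma hy_continuous : continuous (hy : heis R -> R).
Proof.
move=> p A /nbhs_ballP[e /= e0 eA]; apply/nbhs_ballP; exists e => // q.
by move=> /ball_sub_hbox [_ h _]; apply: eA; rewrite /ball/= distrC.
Qed.

(** The distance controls the last coordinate of p^-1 q, which differs from [ht q - ht p] by a term
    linear in the horizontal differences, with coefficients depending on p. The constant C absorbs
    that term for distances d <= 1, where d^2 <= d. *)
Lemma ht_continuous : continuous (ht : heis R -> R).
Proof.
move=> p A /nbhs_ballP[e /= e0 eA]; apply/nbhs_ballP.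
pose C := 1 + 2 * (`|hx p| + `|hy p|).
have C0 : 0 < C by rewrite ltr_wpDr// mulr_ge0// addr_ge0.
pose d := Num.min 1 (e / C).
have d0 : 0 < d by rewrite lt_min ltr01 divr_gt0.
have d1 : d <= 1 by rewrite ge_min lexx.
have dC : d * C <= e by rewrite -ler_pdivlMr// ge_min lexx orbT.
exists d => // q /ball_sub_hbox [hX hY hT]; apply: eA; rewrite /ball/= distrC.
have -> : ht q - ht p = (q.2 - (p.2 + 2 * (p.1.2 * q.1.1 - p.1.1 * q.1.2))) +
    2 * (hy p * (q.1.1 - p.1.1) - hx p * (q.1.2 - p.1.2)).
  by rewrite /ht /hx /hy; ring.
apply: le_lt_trans (ler_normD _ _) _.
apply: (@lt_le_trans _ _ (d * C)) => //.
rewrite /C (mulrDr d) mulr1; apply: ltr_leD.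
  by apply: lt_le_trans hT _; rewrite expr2 ler_piMr// ltW.
rewrite normrM ger0_norm// mulrCA ler_pM2l//.
apply: le_trans (ler_normB _ _) _; rewrite !normrM mulrDr addrC !(mulrC `|_| `|_ - _|).
by apply: lerD; apply: ler_wpM2r => //; exact: ltW.
Qed.

(** The fourth power of the distance from [f s] to [f u] is a polynomial in the coordinates of
    [f u], and it vanishes at u = s. *)
Lemma heis_continuous (T : topologicalType) (f : T -> heis R) :
  continuous (hx \o f) -> continuous (hy \o f) -> continuous (ht \o f) ->
  continuous f.
Proof.
move=> cx cy ct s.
pose G u := ((hx (f u) - hx (f s)) ^+ 2 + (hy (f u) - hy (f s)) ^+ 2) ^+ 2 +
  (ht (f u) - (ht (f s) + 2 * (hy (f s) * hx (f u) - hx (f s) * hy (f u)))) ^+ 2.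
have cG : continuous G.
  by apply: contD; apply: contX; do ![apply: contD|apply: contX|apply: contN|
    apply: contM|apply: contC|exact: cx|exact: cy|exact: ct].
move=> A /nbhs_ballP[e /= e0 eA].
have e40 : 0 < e ^+ 4 by rewrite exprn_gt0.
have oG : open [set u | G u < e ^+ 4] by exact: open_lt_cont.
have Gs : G s < e ^+ 4 by rewrite /G -hdist_eq hdistxx expr0n.
apply: filterS (open_nbhs_nbhs (conj oG Gs)) => u; rewrite /= /G -hdist_eq => Gu.
apply: eA; rewrite hballE /=.
by rewrite -(@ltr_pXn2r _ 4)// ?nnegrE ?hdist_ge0// ltW.
Qed.

Lemma compact_hbounded (F : set (heis R)) (b : R) :
  closed F -> (forall p, F p -> [/\ `|hx p| <= b, `|hy p| <= b & `|ht p| <= b]) ->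
  compact F.
Proof.
move=> cF Fb.
pose K : set (R * R * R) := `[-b, b] `*` `[-b, b] `*` `[-b, b].
have cK : compact K by do !apply: compact_setX; exact: segment_compact.
(* The identity, from the product topology to that of the distance; its continuity carries
   compactness of the box over. *)
pose i (p : R * R * R) : heis R := p.
have ci : continuous i.
  apply: heis_continuous => p.
  - by apply: (@continuous_comp _ _ _ fst fst); [exact: cvg_fst|exact: cvg_fst].
  - by apply: (@continuous_comp _ _ _ fst snd); [exact: cvg_fst|exact: cvg_snd].
  - exact: cvg_snd.
have ciK : compact (i @` K).
  by apply: continuous_compact => //; exact: continuous_subspaceT.
rewrite -(@setIidl _ F (i @` K)); last first.
  move=> p /Fb[h1 h2 h3]; exists p => //.
  by rewrite /K /= !in_itv/= -!ler_norml.
by rewrite setIC; exact: compact_closedI.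
Qed.

(** A Euclidean segment and not a Heisenberg geodesic: [kF] is convex and [kL o] is affine along
    it. *)
Definition seg p q (s : R) : heis R :=
  ((1 - s) * hx p + s * hx q, (1 - s) * hy p + s * hy q, (1 - s) * ht p + s * ht q).

Lemma seg_continuous p q : continuous (seg p q).
Proof.
have lin (a b : R) : continuous (fun s : R => (1 - s) * a + s * b).
  by apply: contD; apply: contM; do ?[exact: contC];
    [apply: contD; [exact: contC|apply: contN]|] => x.
apply: heis_continuous; exact: lin.
Qed.

Lemma seg0 p q : seg p q 0 = p.
Proof. by case: p => [[x y] t]; rewrite /seg /hx /hy /ht/= subr0 !mul1r !mul0r !addr0. Qed.

Lemma seg1 p q : seg p q 1 = q.
Proof. by case: q => [[x y] t]; rewrite /seg /hx /hy /ht/= subrr !mul1r !mul0r !add0r. Qed.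

Lemma convex_connected (A : set (heis R)) :
  (forall p q s, A p -> A q -> 0 <= s <= 1 -> A (seg p q s)) -> connected A.
Proof.
move=> cA; have [[p Ap]|A0] := pselect (A !=set0); last first.
  rewrite (_ : A = set0); first exact: connected0.
  by rewrite -subset0 => q Aq; apply: A0; exists q.
have -> : A = \bigcup_(q in A) (seg p q @` `[0, 1]).
  apply/seteqP; split=> q.
    by move=> Aq; exists q => //; exists 1; [rewrite /= in_itv/= ler01 lexx|exact: seg1].
  by move=> [r Ar [s /=]]; rewrite in_itv/= => s01 <-; exact: cA.
apply: bigcup_connected.
  by exists p => q Aq; exists 0; [rewrite /= in_itv/= ler01 lexx|exact: seg0].
move=> q _; apply: connected_continuous_connected; first exact: segment_connected.
by apply: continuous_subspaceT; exact: seg_continuous.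
Qed.

Lemma closure_seg (A : set (heis R)) p q :
  (forall s, 0 < s < 1 -> A (seg p q s)) -> closure A q.
Proof.
move=> As B; rewrite -{1}(seg1 p q) => nB.
have := @seg_continuous p q 1 B nB => /nbhs_ballP[d /= d0 dB].
pose s := Num.max (1 / 2) (1 - d / 2).
have s1 : s < 1 by rewrite gt_max; apply/andP; split; lra.
have s0 : 0 < s by rewrite lt_max; apply/orP; left; lra.
exists (seg p q s); split; first by apply: As; rewrite s0.
apply: dB; rewrite /ball/= gtr0_norm ?subr_gt0//.
have : 1 - d / 2 <= s by rewrite le_max lexx orbT.
lra.
Qed.

End heis_topology.

Section koranyi_slices.
Context {R : realType}.
Implicit Types p q o : heis R.

Definition kF p : R := (hx p ^+ 2 + hy p ^+ 2) ^+ 2 + ht p ^+ 2.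

(* The derivative of [kF] at [o], in the direction [p - o]. *)
Definition kL o p : R :=
  4 * (hx o ^+ 2 + hy o ^+ 2) * (hx o * (hx p - hx o) + hy o * (hy p - hy o)) +
  2 * ht o * (ht p - ht o).

Lemma kFE p : kF p = hnorm p ^+ 4.
Proof. by case: p => [[x y] t]; rewrite hnorm4. Qed.

Lemma kF_continuous : continuous (kF : heis R -> R).
Proof.
by apply: contD; apply: contX; [apply: contD; apply: contX|];
  [exact: hx_continuous|exact: hy_continuous|exact: ht_continuous].
Qed.

Lemma kL_continuous o : continuous (kL o : heis R -> R).
Proof.
apply: contD; apply: contM; do ?exact: contC.
  by apply: contD; (apply: contM; first exact: contC); apply: contD;
    do ?exact: contC; [exact: hx_continuous|exact: hy_continuous].
by apply: contD; [exact: ht_continuous|exact: contC].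
Qed.

Lemma kF_ball : ball (@hzero R) 1 = [set p | kF p < 1].
Proof.
have E p : hdist hzero p = hnorm p.
  by case: p => [[x y] t]; rewrite /hdist; congr hnorm; congr (_, _, _); ring.
rewrite hballE; apply/seteqP; split=> p /=; rewrite kFE E => h.
  by rewrite exprn_ilt1// hnorm_ge0.
by rewrite -(@ltr_pXn2r _ 4)// ?nnegrE ?hnorm_ge0// expr1n.
Qed.

(** The function x^2 + y^2 is convex and nonnegative, and squaring is convex and increasing on
    nonnegative numbers; t^2 is convex too. *)
Lemma kF_seg p q s : 0 <= s <= 1 -> kF (seg p q s) <= (1 - s) * kF p + s * kF q.
Proof.
move=> /andP[s0 s1]; have s1' : 0 <= 1 - s by rewrite subr_ge0.
have sq (a b : R) : ((1 - s) * a + s * b) ^+ 2 <= (1 - s) * a ^+ 2 + s * b ^+ 2.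
  rewrite -subr_ge0 (_ : _ - _ = s * (1 - s) * (a - b) ^+ 2); last by ring.
  by rewrite mulr_ge0 ?sqr_ge0// mulr_ge0.
rewrite /kF /seg /hx /hy /ht /=.
set u := (X in X ^+ 2 + _ <= _); set v := p.1.1 ^+ 2 + p.1.2 ^+ 2.
set w := q.1.1 ^+ 2 + q.1.2 ^+ 2.
have u0 : 0 <= u by rewrite addr_ge0// sqr_ge0.
have uvw : u <= (1 - s) * v + s * w.
  have := sq p.1.1 q.1.1; have := sq p.1.2 q.1.2; rewrite /u /v /w; lra.
have u2 : u ^+ 2 <= ((1 - s) * v + s * w) ^+ 2.
  by rewrite ler_pXn2r// nnegrE// (le_trans u0).
have := sq v w; have := sq p.2 q.2; lra.
Qed.

Lemma kL_seg o p q s : kL o (seg p q s) = (1 - s) * kL o p + s * kL o q.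
Proof. by rewrite /kL /seg /hx /hy /ht /=; ring. Qed.

Lemma kLxx o : kL o o = 0.
Proof. by rewrite /kL; ring. Qed.

Section at_sphere_point.
Variable o : heis R.
Hypothesis o1 : kF o = 1.

Let s0 := hx o ^+ 2 + hy o ^+ 2.

(* A quantitative form of the strict convexity of the Koranyi ball. *)
Lemma kF_kL p : kF p - 1 = kL o p +
  2 * s0 * ((hx p - hx o) ^+ 2 + (hy p - hy o) ^+ 2) +
  (hx p ^+ 2 + hy p ^+ 2 - s0) ^+ 2 + (ht p - ht o) ^+ 2.
Proof. by rewrite -[X in _ - X]o1 /kL /kF /s0; ring. Qed.

Let s0_ge0 : 0 <= s0. Proof. by rewrite addr_ge0// sqr_ge0. Qed.

Lemma kL_lt0 p : kF p < 1 -> kL o p < 0.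
Proof.
move=> p1; have := kF_kL p; have := s0_ge0 => h0.
have : 0 <= 2 * s0 * ((hx p - hx o) ^+ 2 + (hy p - hy o) ^+ 2).
  by apply: mulr_ge0; [apply: mulr_ge0|apply: addr_ge0; exact: sqr_ge0].
have := sqr_ge0 (hx p ^+ 2 + hy p ^+ 2 - s0); have := sqr_ge0 (ht p - ht o); lra.
Qed.

(** The exact value is -2 - 2 s0^2. Thus the centre of the ball lies strictly below every level -c
    with c < 1. *)
Lemma kL_zero : kL o hzero <= - 2.
Proof.
have := o1; rewrite /kF -/s0 /kL /hzero /hx /hy /ht /= -/(hx o) -/(hy o) -/(ht o) => E.
have -> : 4 * (hx o ^+ 2 + hy o ^+ 2) * (hx o * (0 - hx o) + hy o * (0 - hy o)) +
   2 * ht o * (0 - ht o) = - 2 * (s0 ^+ 2 + ht o ^+ 2) - 2 * s0 ^+ 2.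
  by rewrite /s0; ring.
by rewrite E; have := sqr_ge0 s0; lra.
Qed.

(* At the poles [s0 = 0] the second summand of the constant is 1 / 0 = 0. *)
Lemma slice_near c p : 0 < c -> c <= 1 -> kF p <= 1 -> - c <= kL o p ->
  hdist o p ^+ 4 <= (6 + 1 / (4 * s0 ^+ 2)) * c.
Proof.
move=> c0 c1 p1 Lp; rewrite hdist_eq.
set W := (hx p - hx o) ^+ 2 + (hy p - hy o) ^+ 2.
have W0 : 0 <= W by rewrite addr_ge0// sqr_ge0.
have E := kF_kL p; rewrite -/W in E.
have h0 := s0_ge0.
have e1 : 0 <= 2 * s0 * W by rewrite !mulr_ge0.
have e2 := sqr_ge0 (hx p ^+ 2 + hy p ^+ 2 - s0).
have e3 := sqr_ge0 (ht p - ht o).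
have W1 : 2 * s0 * W <= c by lra.
have T1 : (ht p - ht o) ^+ 2 <= c by lra.
have S1 : (hx p ^+ 2 + hy p ^+ 2 - s0) ^+ 2 <= c by lra.
set b := hx o * (hy p - hy o) - hy o * (hx p - hx o).
have -> : ht p - (ht o + 2 * (hy o * hx p - hx o * hy p)) = ht p - ht o + 2 * b.
  by rewrite /b; ring.
have b2 : b ^+ 2 <= s0 * W.
  rewrite -subr_ge0 (_ : _ - _ = (hx o * (hx p - hx o) + hy o * (hy p - hy o)) ^+ 2).
    exact: sqr_ge0.
  by rewrite /b /W /s0; ring.
have T2 : (ht p - ht o + 2 * b) ^+ 2 <= 2 * (ht p - ht o) ^+ 2 + 8 * b ^+ 2.
  rewrite -subr_ge0 (_ : _ - _ = (ht p - ht o - 2 * b) ^+ 2) ?sqr_ge0//; ring.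
(* The 6 is accounted for: the twisted t-difference contributes at most 2c + 8 b^2 <= 2c + 8 s0 W <=
   6c. For W^2 there are two cases. Off the poles, 2 s0 W <= c gives W^2 <= c^2 / (4 s0^2); at a
   pole W is the squared modulus of the z-part of p, and [S1] bounds its square by c. *)
suff W2 : W ^+ 2 <= 1 / (4 * s0 ^+ 2) * c \/ W ^+ 2 <= c /\ s0 = 0.
  have i0 : 0 <= 1 / (4 * s0 ^+ 2) * c.
    apply: mulr_ge0; last exact: ltW.
    by apply: divr_ge0 => //; apply: mulr_ge0 => //; exact: sqr_ge0.
  rewrite mulrDl; case: W2 => [W2|[W2 s00]]; first lra.
  by move: b2; rewrite s00 mul0r => b2; lra.
have [s00|s0n] := eqVneq s0 0.
  right; split=> //; move: S1; rewrite s00 subr0.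
  move: s00 => /eqP; rewrite paddr_eq0 ?sqr_ge0// !sqrf_eq0 => /andP[/eqP x0 /eqP y0].
  by rewrite /W x0 y0 !subr0.
left; have s0p : 0 < s0 by rewrite lt_neqAle eq_sym s0n.
have -> : 1 / (4 * s0 ^+ 2) * c = c / (2 * s0) ^+ 2 by field.
rewrite ler_pdivlMr ?exprn_gt0 ?mulr_gt0// -exprMn.
have : (W * (2 * s0)) ^+ 2 <= c ^+ 2.
  by rewrite ler_pXn2r// ?nnegrE ?mulr_ge0 ?(ltW c0)//; lra.
move=> /le_trans; apply; rewrite expr2; rewrite ler_piMr// ltW//.
Qed.

Lemma slice_small (e : R) : 0 < e -> exists2 d, 0 < d & forall c p,
  c <= d -> kF p <= 1 -> - c <= kL o p -> hdist o p < e.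
Proof.
move=> e0; set C := 6 + 1 / (4 * s0 ^+ 2).
have C0 : 0 < C.
  apply: ltr_wpDr => //; apply: divr_ge0 => //; apply: mulr_ge0 => //.
  exact: sqr_ge0.
have e40 : 0 < e ^+ 4 by rewrite exprn_gt0.
(* The factor 2 yields a strict inequality. [slice_near] is applied at d, since c itself may fail to
   be positive. *)
pose d := Num.min 1 (e ^+ 4 / (2 * C)).
have d0 : 0 < d by rewrite lt_min ltr01 divr_gt0// mulr_gt0.
exists d => // c p cd p1 Lp.
have d1 : d <= 1 by rewrite ge_min lexx.
have := @slice_near d p d0 d1 p1; rewrite -/C => /(_ _)/le_lt_trans h.
rewrite -(@ltr_pXn2r _ 4)// ?nnegrE ?hdist_ge0 ?(ltW e0)//.
apply: h; first by apply: le_trans Lp; rewrite lerN2.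
apply: (@le_lt_trans _ _ (e ^+ 4 / 2)); last by lra.
have : d <= e ^+ 4 / (2 * C) by rewrite ge_min lexx orbT.
rewrite ler_pdivlMr ?mulr_gt0//; lra.
Qed.

(** p is the point of the radius towards o at level -c. Moving p horizontally, orthogonally to the
    z-part of o, changes neither [kL o] nor [ht], and leads to a point q of the sphere. So p shows
    that the slice is nonempty and q that it reaches the sphere. *)
Lemma slice_points (c : R) : 0 < c < 1 -> exists p q,
  [/\ kF p < 1, kL o p = - c, kF q = 1 & kL o q = - c].
Proof.
move=> /andP[c0 c1]; have L0 := kL_zero.
set l := kL o hzero in L0.
(* [kL o] is affine on the radius, with value l at the centre and 0 at o, so it equals (1 - k) l =
   -c at parameter k. *)
pose k := 1 + c / l.
have ln : l != 0 by lra.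
have kc : 0 < 1 - k by rewrite /k opprD addNKr -mulrN -invrN divr_gt0//; lra.
have k0 : 0 < k.
  rewrite /k; suff : - (c / l) < 1 by lra.
  by rewrite -mulrN -invrN ltr_pdivrMr; lra.
pose p := seg hzero o k.
have F0 : kF hzero = 0 by rewrite kFE hnorm0 expr0n.
have p1 : kF p < 1.
  apply: le_lt_trans (kF_seg _ _ _) _; first by rewrite (ltW k0)/=; lra.
  by rewrite F0 o1 mulr0 add0r mulr1; lra.
have Lp : kL o p = - c.
  by rewrite kL_seg kLxx mulr0 addr0 -/l /k; field.
have [v1 [v2 [v0 vv]]] : exists v1 v2 : R,
    hx o * v1 + hy o * v2 = 0 /\ v1 ^+ 2 + v2 ^+ 2 = 1.
  have [s00|s0n] := eqVneq s0 0.
    exists 1, 0; move: s00 => /eqP; rewrite paddr_eq0 ?sqr_ge0// !sqrf_eq0.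
    by move=> /andP[/eqP -> /eqP ->]; split; ring.
  exists (- hy o / Num.sqrt s0), (hx o / Num.sqrt s0); split; first by ring.
  rewrite !exprMn sqrrN exprVn sqr_sqrtr ?s0_ge0// -mulrDl addrC -/s0 divff//.
pose zp := hx p ^+ 2 + hy p ^+ 2.
have zp0 : 0 <= zp by rewrite addr_ge0// sqr_ge0.
have tp : 0 <= 1 - ht p ^+ 2.
  by move: p1; rewrite /kF -/zp; have := sqr_ge0 zp; lra.
have zs : zp <= Num.sqrt (1 - ht p ^+ 2).
  rewrite -(@ler_pXn2r _ 2)// ?nnegrE ?sqrtr_ge0// sqr_sqrtr//.
  by move: p1; rewrite /kF -/zp; lra.
(* The z-part of p is k times that of o, so it is orthogonal to v, and a shift by s v adds s^2 to
   zp. This s solves (zp + s^2)^2 + (ht p)^2 = 1. *)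
pose s := Num.sqrt (Num.sqrt (1 - ht p ^+ 2) - zp).
have s2 : s ^+ 2 = Num.sqrt (1 - ht p ^+ 2) - zp by rewrite sqr_sqrtr// subr_ge0.
exists p, (hx p + s * v1, hy p + s * v2, ht p); split=> //; rewrite ?/kF ?/kL /=.
  rewrite /kF {1 2 3}/hx {1 2}/hy {1}/ht /=.
  have px : hx p = k * hx o by rewrite /p /seg /hx /=; ring.
  have py : hy p = k * hy o by rewrite /p /seg /hy /=; ring.
  have -> : (hx p + s * v1) ^+ 2 + (hy p + s * v2) ^+ 2 =
     zp + s ^+ 2 * (v1 ^+ 2 + v2 ^+ 2) + 2 * s * k * (hx o * v1 + hy o * v2).
    by rewrite /zp px py; ring.
  by rewrite vv v0 s2 mulr0 addr0 mulr1 subrKC sqr_sqrtr// subrK.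
rewrite -Lp /kL.
transitivity (4 * (hx o ^+ 2 + hy o ^+ 2) *
  (hx o * (hx p - hx o) + hy o * (hy p - hy o) + s * (hx o * v1 + hy o * v2)) +
  2 * ht o * (ht p - ht o)).
  by rewrite /hx /hy /ht /=; ring.
by rewrite v0 mulr0 addr0.
Qed.

End at_sphere_point.

Lemma boundary_kball : boundary (ball (@hzero R) 1) = [set p | kF p = 1].
Proof.
rewrite /boundary kF_ball; apply/seteqP; split=> p /=.
  have oF : open [set p : heis R | kF p < 1].
    by apply: open_lt_cont; exact: kF_continuous.
  rewrite (_ : interior _ = [set p | kF p < 1]); last exact/interior_id.
  move=> [cp /negP]; rewrite -leNgt => p1; apply/le_anti; rewrite p1 andbT.
  have cF : closed [set p : heis R | kF p <= 1].
    by apply: closed_le_cont; exact: kF_continuous.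
  rewrite closure_id in cF; change ([set p : heis R | kF p <= 1] p).
  by rewrite cF; apply: closureS cp => q /= /ltW.
move=> p1; split; last by move=> /interior_subset /=; rewrite p1 ltxx.
apply: (@closure_seg _ _ hzero) => s /andP[s0 s1] /=.
apply: le_lt_trans (kF_seg _ _ _) _; first by rewrite !ltW.
by rewrite p1 kFE hnorm0 expr0n/= mulr0 add0r mulr1.
Qed.

End koranyi_slices.

(** * The prime end at a collared boundary point *)

Section compactness.
Context {R : realType}.
Implicit Types (A F : set (heis R)) (o : heis R).

(** Each point of A has a ball that misses F; half its radius works for all nearby points, and the
    near-covering form of compactness makes the radius uniform. *)
Lemma compact_hdist_gt0 A F : compact A -> closed F -> A `&` F = set0 ->
  exists2 d, 0 < d & forall p q, A p -> F q -> d <= hdist p q.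
Proof.
move=> cA cF AF.
have H : \forall d \near (0 : R)^'+, A `<=` [set p | ball p d `&` F = set0].
  apply: ((compact_near_coveringP A).1 cA R _ (fun d p => ball p d `&` F = set0)).
  move=> p Ap.
  have nFp : (~` F) p by move=> Fp; have : (A `&` F) p by []; rewrite AF.
  have := open_nbhs_nbhs (conj (closed_openC cF) nFp).
  move=> /nbhs_ballP[e /= e0 eF].
  have e20 : 0 < e / 2 by rewrite divr_gt0.
  exists (ball p (e / 2), [set d : R | d < e / 2]); last first.
    move=> [p' d] /= [pp' de]; rewrite -subset0 => q [p'q Fq].
    apply: (eF q) => //; move: pp' p'q; rewrite !hballE /= => h1 h2.
    by apply: le_lt_trans (hdist_triangle p' _ _) _; lra.
  by split=> /=; [exact: nbhsx_ballx|exact: nbhs_right_lt].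
have [d [d0 dA]] := filter_ex (filterI (nbhs_right_gt (0 : R)) H).
exists d => // p q Ap Fq; rewrite leNgt; apply/negP => pq.
have : (ball p d `&` F) q by rewrite hballE.
by rewrite (dA p Ap).
Qed.

Lemma compact_hball o A : compact A -> exists2 r, 0 <= r & A `<=` ball o r.
Proof.
move=> cA.
have H : \forall r \near +oo, A `<=` [set p | hdist o p < r].
  apply: ((compact_near_coveringP A).1 cA R _ (fun r p => hdist o p < r)).
  move=> p Ap; exists (ball p 1, [set r : R | hdist o p + 1 < r]); last first.
    move=> [p' r] /= []; rewrite hballE /= => pp' pr.
    by apply: le_lt_trans (hdist_triangle p _ _) _; lra.
  by split=> /=; [exact: nbhsx_ballx|apply: nbhs_pinfty_gt; rewrite num_real].
have [r [r0 rA]] := filter_ex (filterI (nbhs_pinfty_gt (@num_real R 0)) H).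
by exists r; [exact: ltW|move=> p /rA; rewrite hballE].
Qed.

End compactness.

Section collar.
Context {R : realType}.
Variables (O U S : set (heis R)) (h g : heis R -> heis R) (x : heis R) (c0 : R).

Let o := h x.
Let Y := h @` (U `|` S).

Hypotheses (oO : open O) (cO : connected O) (UO : U `<=` O) (oU : open U).
Hypothesis SO : S `<=` boundary O.
Hypothesis hU : h @` U = [set p | kF p < 1].
Hypothesis hS : forall p, S p -> kF (h p) = 1.
Hypothesis ch : {within U, continuous h}.
Hypothesis cg : {within Y, continuous g}.
Hypothesis hK : {in U `|` S, cancel h g}.
Hypothesis Sx : S x.
Hypothesis c0lt1 : c0 < 1.
Hypothesis cap : forall q, kF q = 1 -> - c0 <= kL o q -> (h @` S) q.

(** Q is a set of levels, so that a single level and the parts above and below it share their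
    lemmas. [ballslice] is the image of [slice] under h; [capslice] adds points of the sphere to
    gain compactness. *)
Definition ballslice (Q : set R) : set (heis R) := [set q | kF q < 1 /\ Q (kL o q)].
Definition capslice (Q : set R) : set (heis R) := [set q | kF q <= 1 /\ Q (kL o q)].
Definition slice (Q : set R) : set (heis R) := [set p | U p /\ Q (kL o (h p))].

Let o1 : kF o = 1. Proof. exact: hS. Qed.

Let gK p : U p -> g (h p) = p.
Proof. by move=> Up; apply: hK; rewrite inE; left. Qed.

Lemma slice_image Q : slice Q = g @` ballslice Q.
Proof.
apply/seteqP; split=> p.
  move=> [Up Qp]; exists (h p); last exact: gK.
  split=> //; have : (h @` U) (h p) by exists p.
  by rewrite hU.
move=> [q [q1 Qq] <-]; have : (h @` U) q by rewrite hU.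
by move=> [p' Up' E]; rewrite -E gK//; split=> //; rewrite E.
Qed.

Lemma ballslice_sub Q : ballslice Q `<=` Y.
Proof.
move=> q [q1 _]; have : (h @` U) q by rewrite hU.
by move=> [p Up <-]; exists p => //; left.
Qed.

Lemma slice_sub Q : slice Q `<=` O.
Proof. by move=> p [/UO]. Qed.

Lemma slice_connected (Q : set R) :
  (forall a b s, Q a -> Q b -> 0 <= s <= 1 -> Q ((1 - s) * a + s * b)) ->
  connected (slice Q).
Proof.
move=> cQ; rewrite slice_image; apply: connected_continuous_connected; last first.
  exact: continuous_subspaceW (@ballslice_sub Q) cg.
apply: convex_connected => p q s [p1 Qp] [q1 Qq] /andP[s0 s1]; split.
  apply: le_lt_trans (kF_seg _ _ _) _; first by rewrite s0.
  have [->|sn] := eqVneq s 0; first by rewrite subr0 mul1r mul0r addr0.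
  have sp : 0 < s by rewrite lt_neqAle eq_sym sn.
  have h1 : (1 - s) * kF p <= (1 - s) * 1 by rewrite ler_wpM2l ?subr_ge0// ltW.
  have h2 : s * kF q < s * 1 by rewrite ltr_pM2l.
  by lra.
by rewrite kL_seg; apply: cQ; rewrite ?s0.
Qed.

Lemma slice_open (Q : set R) : open Q -> open (slice Q).
Proof.
move=> oQ; have : open (kL o @^-1` Q).
  by apply: open_comp => // p _; exact: kL_continuous.
exact: open_setI_preimage.
Qed.

(** This is where [c0] enters: above level -c0 the sphere is covered by h(S), so the closed caps
    stay where g is continuous. *)
Lemma capslice_sub Q : Q `<=` [set t | - c0 <= t] -> capslice Q `<=` Y.
Proof.
move=> Qc q [q1 Qq]; move: q1; rewrite le_eqVlt => /predU1P[q1|q1].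
  by have [p Sp <-] := cap q1 (Qc _ Qq); exists p => //; right.
by apply: (@ballslice_sub Q).
Qed.

Lemma capslice_compact Q : closed Q -> compact (capslice Q).
Proof.
move=> cQ; apply: (@compact_hbounded _ _ 1).
  apply: closedI; first by apply: closed_le_cont; exact: kF_continuous.
  by apply: preimage_closed => // p _; exact: kL_continuous.
move=> p [p1 _]; have N0 := hnorm_ge0 p.
have N1 : hnorm p <= 1.
  by rewrite -(@ler_pXn2r _ 4)// ?nnegrE// -kFE expr1n.
have N2 : hnorm p ^+ 2 <= 1 by rewrite exprn_ile1.
move: p N1 N2 {p1 N0} => [[a b] t] N1 N2; have [ha hb hc] := hnorm_coord a b t.
by split; [exact: le_trans ha N1|exact: le_trans hb N1|exact: le_trans hc N2].
Qed.

Lemma gcap_compact Q : closed Q -> Q `<=` [set t | - c0 <= t] ->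
  compact (g @` capslice Q).
Proof.
move=> cQ Qc; apply: continuous_compact; last exact: capslice_compact.
by apply: continuous_subspaceW cg; exact: capslice_sub.
Qed.

Lemma gcap_closed Q : closed Q -> Q `<=` [set t | - c0 <= t] ->
  closed (g @` capslice Q).
Proof.
by move=> cQ Qc; apply: compact_closed; [exact: metric_hausdorff|exact: gcap_compact].
Qed.

Lemma slice_gcap (Q Q' : set R) : Q `<=` Q' -> slice Q `<=` g @` capslice Q'.
Proof.
rewrite slice_image => QQ p [q [q1 Qq] <-]; exists q => //.
by split; [exact: ltW|exact: QQ].
Qed.

(** The points of the cap on the sphere are sent into S, hence to the boundary of the open set O and
    outside O. With [gcap_closed], this shows that such slices are relatively closed in O when Q is
    closed. *)
Lemma gcap_slice Q : Q `<=` [set t | - c0 <= t] ->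
  (g @` capslice Q) `&` O = slice Q.
Proof.
move=> Qc; apply/seteqP; split=> p; last first.
  by move=> sp; split; [exact: slice_gcap sp|exact: slice_sub sp].
move=> [[q [q1 Qq] <-] Op]; rewrite slice_image; exists q => //; split=> //.
rewrite lt_neqAle q1 andbT; apply/eqP => qE.
have [p' Sp' E] := cap qE (Qc _ Qq).
have gq : g q = p' by rewrite -E hK// inE; right.
by have [_] := SO Sp'; apply; rewrite -gq (interior_id O).1.
Qed.

(** Approach to the sphere inside the ball is carried by g to approach to the boundary of O; this
    supplies boundary points for the cross-set conditions. *)
Lemma slice_closure (Q : set R) q : kF q = 1 -> - c0 <= kL o q ->
  closure (ballslice Q) q -> closure (slice Q) (g q) /\ boundary O (g q).
Proof.
move=> q1 qc cq; have [p Sp E] := cap q1 qc; split; last first.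
  by rewrite -E hK ?inE; [exact: SO|right].
rewrite slice_image; apply: (closure_image_within cg) => //.
  by rewrite -E; exists p => //; right.
exact: ballslice_sub.
Qed.

(** * A single level is a cross-set *)

Section one_slice.
Variable c : R.
Hypotheses (c_gt0 : 0 < c) (c_le : c <= c0).

Let ccl : [set - c] `<=` [set t : R | - c0 <= t].
Proof. by move=> t -> /=; rewrite lerN2. Qed.

Let cge : [set t | - c <= t] `<=` [set t : R | - c0 <= t].
Proof. by move=> t /=; apply: le_trans; rewrite lerN2. Qed.

Local Notation E := (slice [set - c]).
Local Notation D := (slice [set t | - c < t]).
Local Notation L := (slice [set t | t < - c]).
Local Notation W := (O `\` slice [set t | - c <= t]).

Let points : exists p q,
  [/\ kF p < 1, kL o p = - c, kF q = 1 & kL o q = - c].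
Proof. by apply: slice_points => //; rewrite c_gt0 (le_lt_trans c_le). Qed.

Let conv_lt a b s : a < - c -> b < - c -> 0 <= s <= 1 -> (1 - s) * a + s * b < - c.
Proof.
move=> ac bc /andP[s0 s1]; have [->|sn] := eqVneq s 0; first by lra.
have sp : 0 < s by rewrite lt_neqAle eq_sym sn.
have h1 : (1 - s) * a <= (1 - s) * - c by rewrite ler_wpM2l ?subr_ge0// ltW.
have h2 : s * b < s * - c by rewrite ltr_pM2l.
lra.
Qed.

Lemma level_connected : connected E.
Proof. by apply: slice_connected => a b s -> -> _ /=; ring. Qed.

Lemma upper_connected : connected D.
Proof.
apply: slice_connected => a b s /= ac bc /andP[s0 s1].
have [->|sn] := eqVneq s 0; first by lra.
have sp : 0 < s by rewrite lt_neqAle eq_sym sn.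
have h1 : (1 - s) * - c <= (1 - s) * a by rewrite ler_wpM2l ?subr_ge0// ltW.
have h2 : s * - c < s * b by rewrite ltr_pM2l.
lra.
Qed.

Lemma lower_connected : connected L.
Proof. by apply: slice_connected => a b s /=; exact: conv_lt. Qed.

Lemma lower_closed_connected : connected (slice [set t | t <= - c]).
Proof.
apply: slice_connected => a b s /= ac bc /andP[s0 s1].
have h1 : (1 - s) * a <= (1 - s) * - c by rewrite ler_wpM2l ?subr_ge0.
have h2 : s * b <= s * - c by rewrite ler_wpM2l.
lra.
Qed.

Lemma upper_open : open D.
Proof. by apply: slice_open; exact: open_gt. Qed.

Let closed_cge : closed [set t : R | - c <= t].
Proof. exact: closed_ge. Qed.

Lemma lower_side_open : open W.
Proof.
rewrite -(gcap_slice cge) setDE setCI setIUr setICr setU0.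
by apply: openI => //; apply: closed_openC; exact: gcap_closed.
Qed.

Lemma lower_sub : L `<=` W.
Proof.
by move=> p [Up Lp]; split; [exact: UO|move=> [_ /=]; rewrite leNgt Lp].
Qed.

(** q is approached along its radius: the centre lies strictly below level -c, and [kL o] is
    affine. *)
Lemma lower_closure q : kF q = 1 -> kL o q = - c -> closure (ballslice [set t | t < - c]) q.
Proof.
move=> q1 qc; apply: (@closure_seg _ _ hzero) => s /andP[s0 s1]; split.
  apply: le_lt_trans (kF_seg _ _ _) _; first by rewrite !ltW.
  by rewrite q1 kFE hnorm0 expr0n/= mulr0 add0r mulr1.
rewrite /= kL_seg qc; have := kL_zero o1 => z.
have : (1 - s) * kL o hzero < (1 - s) * - c.
  by rewrite ltr_pM2l ?subr_gt0//; have := le_lt_trans c_le c0lt1; lra.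
lra.
Qed.

Lemma lower_neq0 : L !=set0.
Proof.
have [_ [q [_ _ q1 qc]]] := points.
have [z [Lz _]] := lower_closure q1 qc filterT.
by rewrite slice_image; exists (g z), z.
Qed.

(* A relatively clopen part of [W] that misses the connected set [L] also misses
   the open set [U], hence is clopen in [O]. *)
Lemma lower_side_connected : connected W.
Proof.
have key (B1 B2 : set (heis R)) : open B1 -> open B2 -> B1 `&` B2 = set0 ->
    W = B1 `|` B2 -> L `<=` B1 -> B2 = set0.
  move=> o1' o2 d12 WB LB.
  have UB2 z : U z -> B2 z -> False.
    move=> Uz B2z; have Wz : W z by rewrite WB; right.
    have : L z.
      by split=> //=; rewrite ltNge; apply/negP => Lz; case: Wz => _; apply.
    by move=> /LB B1z; have : (B1 `&` B2) z by []; rewrite d12.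
  have OU : O `<=` U `|` B1.
    apply: (@connected_sub_open _ _ _ B2) => //.
    - exact: openU.
    - move=> z Oz; have [sz|nsz] := pselect (slice [set t | - c <= t] z).
        by left; left; case: sz.
      by have : W z by []; rewrite WB => -[]; [left; right|right].
    - by move=> z [[Uz|B1z] B2z] _; [exact: UB2 B2z|have : (B1 `&` B2) z by []; rewrite d12].
    - have [z [Uz _]] := lower_neq0.
      by exists z; split; [exact: UO|left].
  rewrite -subset0 => z B2z; have Wz : W z by rewrite WB; right.
  have [Uz|B1z] := OU _ Wz.1; first exact: UB2 B2z.
  by have : (B1 `&` B2) z by []; rewrite d12.
have oW := lower_side_open.
move=> B B0 [V oV BV] [F cF BF].
pose B' := W `&` ~` F.
have oB : open B by rewrite BV; exact: openI.
have oB' : open B' by apply: openI => //; exact: closed_openC.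
have dB : B `&` B' = set0.
  by rewrite -subset0 => z []; rewrite BF => -[_ Fz] [_].
have WB : W = B `|` B'.
  apply/seteqP; split=> z; last by case; [rewrite BV => -[]|case].
  by move=> Wz; have [Fz|nFz] := pselect (F z); [left; rewrite BF|right].
have LBB : L `<=` B `|` B' by rewrite -WB; exact: lower_sub.
have [LB|LB] : L `&` B !=set0 \/ L `&` B' !=set0.
  have [z Lz] := lower_neq0.
  by have [Bz|Bz] := LBB _ Lz; [left|right]; exists z.
- have B'0 : B' = set0.
    apply: (key B) => //; apply: (connected_sub_open lower_connected oB oB') => //.
    by rewrite dB.
  by rewrite [in RHS]WB B'0 setU0.
- have dB' : B' `&` B = set0 by rewrite setIC.
  have WB' : W = B' `|` B by rewrite setUC.
  have LB' : L `<=` B'.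
    apply: (connected_sub_open lower_connected oB' oB) => //.
      by rewrite setUC.
    by rewrite dB'.
  by move: B0; rewrite (key B' B oB' oB dB' WB' LB') => -[].
Qed.

(** In the ball, o has level 0 and is approached along the segment from a point of level -c, which
    stays above that level. *)
Lemma upper_closure : closure D x.
Proof.
have [p [_ [p1 pc _ _]]] := points.
have gx : g o = x by rewrite /o hK// inE; right.
rewrite slice_image -[X in closure _ X]gx; apply: (closure_image_within cg).
- by exists x => //; right.
- exact: ballslice_sub.
- apply: (@closure_seg _ _ p) => s /andP[s0 s1]; split.
    apply: le_lt_trans (kF_seg _ _ _) _; first by rewrite !ltW.
    have : (1 - s) * kF p < (1 - s) * 1 by rewrite ltr_pM2l// subr_gt0.
    by rewrite o1; lra.
  rewrite /= kL_seg pc kLxx mulr0 addr0.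
  by have := mulr_gt0 s0 c_gt0; lra.
Qed.

Lemma level_diff : O `\` E = W `|` D.
Proof.
apply/seteqP; split=> z.
  move=> [Oz nE]; have [[Uz cz]|nz] := pselect (slice [set t | - c <= t] z).
    right; split=> //=; rewrite lt_neqAle cz andbT; apply/eqP => e.
    by apply: nE; split=> //=; rewrite -e.
  by left.
move=> [[Oz nz]|[Uz cz]].
  by split=> // -[Uz] /= e; apply: nz; split=> //=; rewrite e.
by split; [exact: UO|move=> [_] /= e; move: cz; rewrite /= e ltxx].
Qed.

Lemma sides_disjoint : W `&` D = set0.
Proof.
by rewrite -subset0 => z [[_ nz] [Uz cz]]; apply: nz; split=> //; exact: ltW.
Qed.

Lemma level_components : components (O `\` E) = [set W; D].
Proof.
apply: components_two.
- exact: level_diff.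
- exact: sides_disjoint.
- exact: lower_side_open.
- exact: upper_open.
- exact: lower_side_connected.
- exact: upper_connected.
- by have [z /lower_sub Wz] := lower_neq0; exists z.
- by have [z []] := upper_closure filterT; exists z.
Qed.

Lemma level_cross_set : cross_set O E.
Proof.
have [p [q [p1 pc q1 qc]]] := points.
have q0 : - c0 <= kL o q by rewrite qc lerN2.
split.
- exact: slice_sub.
- exact: level_connected.
- exists (g @` capslice [set - c]); last by rewrite gcap_slice.
  by apply: gcap_closed => //; exact: closed_eq.
- have [|] := @slice_closure [set - c] q q1 q0; last by exists (g q).
  apply: (@closure_seg _ _ p) => s /andP[s0 s1]; split.
    apply: le_lt_trans (kF_seg _ _ _) _; first by rewrite !ltW.
    have : (1 - s) * kF p < (1 - s) * 1 by rewrite ltr_pM2l// subr_gt0.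
    by rewrite q1; lra.
  by rewrite /= kL_seg pc qc; ring.
- exists W, D; split.
  + move=> WD; have [z Lz] := lower_neq0.
    have Wz := lower_sub Lz; have : (W `&` D) z by split=> //; rewrite -WD.
    by rewrite sides_disjoint.
  + exact: level_components.
  + have [cq bq] := slice_closure q1 q0 (lower_closure q1 qc).
    exists (g q); split=> //; split; first exact: closureS lower_sub _ cq.
    by move=> /interior_subset[]; case: bq => _; rewrite (interior_id O).1.
  + exists x; have bx := SO Sx; split=> //; split; first exact: upper_closure.
    by move=> /interior_subset /slice_sub; case: bx => _; rewrite (interior_id O).1.
Qed.

(** W and the preimage of {L <= -c} are connected and share the preimage of {L < -c}.
    [chain_equiv_side] asks for this connectedness. *)
Lemma diff_upper_connected : connected (O `\` D).
Proof.
have -> : O `\` D = W `|` slice [set t | t <= - c].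
  apply/seteqP; split=> z.
    move=> [Oz nD]; have [Uz|nU] := pselect (U z).
      by right; split=> //=; rewrite leNgt; apply/negP => cz; apply: nD.
    by left; split=> // -[].
  move=> [[Oz nz]|[Uz cz]]; split=> //.
  - by move=> [Uz /= cz]; apply: nz; split=> //=; exact: ltW.
  - exact: UO.
  - by move=> [_] /=; rewrite ltNge cz.
apply: connectedU; [|exact: lower_side_connected|exact: lower_closed_connected].
have [z Lz] := lower_neq0; exists z; split; first exact: lower_sub.
by case: Lz => Uz cz; split=> //; exact: ltW.
Qed.

End one_slice.

(** * The chain of levels and its impression *)

Hypothesis c0_gt0 : 0 < c0.

Definition cut (k : nat) : R := c0 / k.+2%:R.
Definition cut_level k := slice [set - cut k].
Local Notation E := cut_level.

Lemma cut_gt0 k : 0 < cut k. Proof. by rewrite divr_gt0. Qed.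

Lemma cut_anti k l : (k < l)%N -> cut l < cut k.
Proof.
by move=> kl; rewrite ltr_pM2l// ltf_pV2 ?posrE ?ltr0n// ltr_nat.
Qed.

Lemma cut_le k : cut k <= c0.
Proof. by rewrite ler_pdivrMr// ler_peMr ?ler1n// ltW. Qed.

Lemma cut_small d : 0 < d -> \forall k \near \oo, cut k <= d.
Proof.
move=> d0; pose n := (Num.trunc (c0 / d)).+1.
have nd : c0 / d < n%:R by exact: truncnS_gt.
exists n => // k /= nk; rewrite ler_pdivrMr//.
move: nd; rewrite ltr_pdivrMr// mulrC => nd; apply: le_trans (ltW nd) _.
by rewrite ler_pM2l// ler_nat (leq_trans nk)// -addn2 leq_addr.
Qed.

Let cge k : [set t | - cut k <= t] `<=` [set t : R | - c0 <= t].
Proof. by move=> t /=; apply: le_trans; rewrite lerN2 cut_le. Qed.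

Lemma cut_chain : chain O E.
Proof.
split=> k; first exact: (level_cross_set (cut_gt0 k) (cut_le k)).
have comp := level_components (cut_gt0 k.+1) (cut_le k.+1).
exists (O `\` slice [set t | - cut k.+1 <= t]), (slice [set t | - cut k.+1 < t]).
have E1 := @cut_anti k k.+1 (leqnn _); have E2 := @cut_anti k.+1 k.+2 (leqnn _).
have EW : E k `<=` O `\` slice [set t | - cut k.+1 <= t].
  move=> z [Uz /= e]; split; first exact: UO.
  by move=> [_] /=; rewrite e lerN2 leNgt E1.
split=> //.
- by rewrite comp; left.
- by rewrite comp; right.
- move=> WD; have [z Ez] := cross_set_neq0 (level_cross_set (cut_gt0 k) (cut_le k)).
  have Wz := EW _ Ez; have : slice [set t | - cut k.+1 < t] z by rewrite -WD.
  by case: Wz => _ nz [Uz /= cz]; apply: nz; split=> //; exact: ltW.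
- by move=> z [Uz /= e]; split=> //=; rewrite e ltrN2.
Qed.

Lemma cut_chain_side k : chain_side O E k = slice [set t | - cut k < t].
Proof.
have [cD ED] := chain_side_component k cut_chain.
have cr := level_cross_set (cut_gt0 k.+1) (cut_le k.+1).
have [z Ez] := cross_set_neq0 cr.
apply: (component_uniq cD _ (ED _ Ez)).
  by rewrite (level_components (cut_gt0 k) (cut_le k)); right.
by case: Ez => Uz /= e; split=> //=; rewrite e ltrN2; exact: cut_anti.
Qed.

(** The caps shrink to o by [slice_small], and g is continuous at o with value x. Both the
    impression and the decay of the modulus rest on this. *)
Lemma gcap_near (e : R) : 0 < e ->
  \forall k \near \oo, g @` capslice [set t | - cut k <= t] `<=` ball x e.
Proof.
move=> e0.
have gx : g o = x by rewrite /o hK// inE; right.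
have Yo : Y o by exists x => //; right.
have : nbhs (o : subspace Y) (g @^-1` ball x e).
  by apply: (cg (x := o)); rewrite /from_subspace gx; exact: nbhsx_ballx.
rewrite /nbhs/= -(nbhs_subspace_in Yo) /within/= => /nbhs_ballP[d /= d0 dP].
have [d' d'0 d'P] := slice_small o1 d0.
have := cut_small d'0; apply: filterS => k kd _ [q [q1 qc] <-].
apply: dP.
  by rewrite hballE; exact: d'P kd q1 qc.
by apply: capslice_sub (cge (k := k)) _ _.
Qed.

Lemma cut_impression : chain_impression O E = [set x].
Proof.
apply/seteqP; split=> [y Ey|_ -> k _]; last first.
  by rewrite cut_chain_side; exact: upper_closure (cut_gt0 k) (cut_le k).
(* The image of the closed cap is closed and contains the side of [E k], hence also its closure. *)
have yg k : (g @` capslice [set t | - cut k <= t]) y.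
  have cl : closed (g @` capslice [set t | - cut k <= t]).
    by apply: gcap_closed => //; exact: closed_ge.
  have := Ey k I; rewrite cut_chain_side closure_id in cl * => cy.
  rewrite cl; apply: closureS cy.
  by apply: slice_gcap => t /= /ltW.
apply/esym/hdist_positivity/le_anti; rewrite hdist_ge0 andbT.
apply/ler_addgt0Pr => e e0; rewrite add0r.
have [k /= Hk] := filter_ex (gcap_near e0).
by have := Hk _ (yg k); rewrite hballE => /ltW.
Qed.

Lemma cut_prime_chain : prime_chain O E.
Proof.
have Nc k : [set - cut k] `<=` [set t : R | - cut k <= t] by move=> t -> /=.
have nOx : ~ O x by case: (SO Sx) => _; rewrite (interior_id O).1.
split; first exact: cut_chain.
- move=> k.
  have cA j : compact (g @` capslice [set - cut j]).
    apply: gcap_compact; first exact: closed_eq.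
    exact: subset_trans (Nc j) (cge (k := j)).
  have [d d0 dP] : exists2 d, 0 < d & forall p q,
      (g @` capslice [set - cut k.+1]) p -> (g @` capslice [set - cut k]) q -> d <= hdist p q.
    apply: compact_hdist_gt0 => //.
      by apply: compact_closed; [exact: metric_hausdorff|exact: cA].
    (* g is injective on Y, being inverse to h there, so a common point would lie on two different
       levels. *)
    rewrite -subset0 => _ [[q [q1 qc] <-] [q' [q'1 q'c] gqq]].
    have gi q1' q2' : Y q1' -> Y q2' -> g q1' = g q2' -> q1' = q2'.
      by move=> [p1 Sp1 <-] [p2 Sp2 <-]; rewrite !hK ?inE// => ->.
    have Yq : Y q by apply: capslice_sub (subset_trans (Nc _) (cge (k := k.+1))) _ _.
    have Yq' : Y q' by apply: capslice_sub (subset_trans (Nc _) (cge (k := k))) _ _.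
    have qq := gi _ _ Yq' Yq gqq.
    have := @cut_anti k k.+1 (leqnn _).
    by move: qc q'c; rewrite /= qq => -> /oppr_inj ->; rewrite ltxx.
  have [r r0 Ar] := compact_hball x (compactU (cA k.+1) (cA k)).
  apply: (@Mod4_joining_lty _ _ _ O x r d) => //.
  + by move=> p q Ep Eq; apply: dP; [exact: slice_gcap Ep|exact: slice_gcap Eq].
  + by move=> p Ep; apply: Ar; left; exact: slice_gcap Ep.
  + by move=> p Ep; apply: Ar; right; exact: slice_gcap Ep.
- move=> K [cK _ _] KO.
  have clK : closed K by apply: compact_closed => //; exact: metric_hausdorff.
  have nKx : (~` K) x by move=> /KO.
  (* K is closed and lies in O, which does not contain x, so some ball around x misses K; its radius
     is the r of the ring estimate. *)
  have := open_nbhs_nbhs (conj (closed_openC clK) nKx).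
  move=> /nbhs_ballP[r /= r0 rK].
  apply: (@Mod4_joining_cvg0 _ cut_level K O x r r0).
  + move=> e e0; have := gcap_near e0; apply: filterS => k; apply: subset_trans.
    exact: slice_gcap.
  + move=> p Kp; rewrite leNgt; apply/negP => xp; exact: (rK p).
Qed.

Lemma collar_prime_end : exists2 P : set (nat -> set (heis R)),
  prime_end O P & impression O P = [set x].
Proof.
exists (chain_class O E); first by exists E => //; exact: cut_prime_chain.
apply: impression_chain_class => //.
- exact: cut_prime_chain.
- by move=> m; rewrite cut_chain_side; exact: diff_upper_connected (cut_gt0 m) (cut_le m).
- move=> p Op; have [Up|nUp] := pselect (U p); last first.
    by exists 0%N; rewrite cut_chain_side => -[].
  have L0 : kL o (h p) < 0.
    apply: kL_lt0 => //; have : (h @` U) (h p) by exists p.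
    by rewrite hU.
  have [m /= Hm] : exists m, cut m <= - kL o (h p).
    have nL0 : 0 < - kL o (h p) by rewrite oppr_gt0.
    by have [m mL] := filter_ex (cut_small nL0); exists m.
  exists m; rewrite cut_chain_side => -[_ /=].
  by rewrite ltrNl ltNge Hm.
- exact: cut_impression.
Qed.

End collar.

Theorem mainTheorem7 (R : realType) (Omega : set (heis R)) (hOmega : collared Omega)
    (x : heis R) (hx : boundary Omega x) :
  exists2 P : set (nat -> set (heis R)),
    prime_end Omega P & impression Omega P = [set x].
Proof.
case: hOmega => -[_ oO cO] /(_ x hx).
move=> [U [h [[_ UO [[_ oU _] _ [hU ch _] _]] Ux [_ _ [g cg hK]]]]].
set S := boundary U `&` boundary Omega in hK cg *.
move=> [hS _ _ [V [oV Vhx VS]]].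
have Sx : S x by [].
have hS1 p : S p -> kF (h p) = 1.
  by move=> Sp; have := hS (h p); rewrite boundary_kball; apply; exists p.
(* Points of the sphere above level -c, for c <= d, are within e of h(x), hence in V and so in h(S).
   The bound 1/2 below keeps c under 1. *)
have /nbhs_ballP[e /= e0 eV] := open_nbhs_nbhs (conj oV Vhx).
have [d d0 dP] := slice_small (hS1 _ Sx) e0.
pose c := Num.min d (1 / 2).
have c0 : 0 < c by rewrite lt_min d0 divr_gt0.
have c1 : c < 1 by rewrite gt_min; apply/orP; right; lra.
rewrite kF_ball in hU.
apply: (@collar_prime_end _ Omega U S h g x c) => //.
- by move=> p [].
- move=> q q1 qc; apply: VS; split; last by rewrite boundary_kball.
  apply: eV; rewrite hballE /=; apply: (dP c q) => //; last by rewrite q1.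
  by rewrite ge_min lexx.
Qed.
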